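(* Let $\varphi:\mathbb D\to\mathbb D$ be a parabolic holomorphic self-map of positive hyperbolic step and let $\psi\in\mathcal Z_\forall(\varphi)$. Suppose that $\varphi\circ\psi\neq\mathrm{id}_{\mathbb D}$. Then $\varphi\circ\psi$ is of positive hyperbolic step if and only if $c_{\varphi,\psi}\in\mathbb R$.
   Context: $\mathbb D$ is the open unit disc, $\mathbb H=\{w\in\mathbb C:\operatorname{Im}w>0\}$. A holomorphic self-map $\varphi$ of $\mathbb D$ is parabolic if its Denjoy–Wolff point (locally uniform limit of the iterates) $\tau$ lies on $\partial\mathbb D$ and the angular derivative satisfies $\varphi'(\tau)=1$. It is of positive (resp. zero) hyperbolic step if $\lim_{n}\rho_{\mathbb D}(\varphi^{\circ n}(z_0),\varphi^{\circ(n+1)}(z_0))$ is positive (resp. zero) for some (equivalently, every) $z_0\in\mathbb D$, where $\rho_{\mathbb D}$ is the hyperbolic distance. The centralizer $\mathcal Z_\forall(\varphi)$ is the set of all holomorphic $\psi:\mathbb D\to\mathbb D$ with $\psi\circ\varphi=\varphi\circ\psi$; for parabolic $\varphi$ all its elements except $\mathrm{id}_{\mathbb D}$ are known to be parabolic. Canonical model. A domain $V\subset\mathbb D$ is $\varphi$-absorbing if $\varphi(V)\subset V$ and $\mathbb D=\bigcup_{n}(\varphi^{\circ n})^{-1}(V)$. For $\varphi$ parabolic of positive hyperbolic step there is a unique triple $(S_\varphi,h_\varphi,z\mapsto z+1)$, the canonical holomorphic model, with $S_\varphi\in\{\mathbb H,-\mathbb H\}$, $h_\varphi:\mathbb D\to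 S_\varphi$ holomorphic, $h_\varphi\circ\varphi=h_\varphi+1$, $S_\varphi=\bigcup_{n\ge0}(h_\varphi(\mathbb D)-n)$, $h_\varphi$ injective on some $\varphi$-absorbing domain, and $\operatorname{Re}h_\varphi(0)=0$. Simultaneous linearization coefficient. For $\varphi$ parabolic of positive hyperbolic step and $\psi\in\mathcal Z_\forall(\varphi)$, $c_{\varphi,\psi}$ is the unique constant $c\in\mathbb C$ for which there exists a holomorphic $\beta:S_\varphi\to\mathbb C$ such that $\beta(w+1)=\beta(w)+1$ for all $w\in S_\varphi$, $\beta\circ h_\varphi\circ\varphi=\beta\circ h_\varphi+1$, and $\beta\circ h_\varphi\circ\psi=\beta\circ h_\varphi+c$. *)

(* Defs.v *)
From Stdlib Require Import Reals.
From Coquelicot Require Import Coquelicot.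
Open Scope R_scope.

Definition unit_disc (z : C) : Prop := Cmod z < 1.
Definition upper_half_plane (w : C) : Prop := 0 < Im w.
Definition lower_half_plane (w : C) : Prop := Im w < 0.

(** Maps are total functions [C -> C]; only their values on the relevant open
    domain matter, and complex differentiability on an open set [D] does not
    depend on the values outside [D]. *)
Definition holomorphic_on (D : C -> Prop) (f : C -> C) : Prop :=
  forall z, D z -> @ex_derive C_AbsRing C_NormedModule f z.

Definition maps_to (A B : C -> Prop) (f : C -> C) : Prop :=
  forall z, A z -> B (f z).

Definition holomorphic_self_map (f : C -> C) : Prop :=
  holomorphic_on unit_disc f /\ maps_to unit_disc unit_disc f.

Definition iterate (f : C -> C) (n : nat) (z : C) : C := Nat.iter n f z.

(** Hyperbolic (Poincare) distance of the disc, normalized to have Gaussian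
    curvature -4. *)
Definition pseudo_hyperbolic (z w : C) : R :=
  Cmod (Cdiv (Cminus z w) (Cminus (RtoC 1) (Cmult (Cconj w) z))).

Definition hyperbolic_dist (z w : C) : R :=
  / 2 * ln ((1 + pseudo_hyperbolic z w) / (1 - pseudo_hyperbolic z w)).

(** Locally uniform convergence on the disc of the iterates to the constant
    [tau]. *)
Definition is_Denjoy_Wolff_point (f : C -> C) (tau : C) : Prop :=
  forall z0, unit_disc z0 ->
  exists r : posreal, forall eps : posreal, exists N : nat,
  forall n z, (N <= n)%nat -> unit_disc z -> Cmod (Cminus z z0) < r ->
    Cmod (Cminus (iterate f n z) tau) < eps.

Definition Stolz_region (tau : C) (M : R) (z : C) : Prop :=
  unit_disc z /\ Cmod (Cminus z tau) < M * (1 - Cmod z).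

(** Angular derivative at a boundary fixed point: the nontangential limit of
    [(f z - tau) / (z - tau)].  Its existence as a finite limit forces [f] to
    have angular limit [tau] at [tau]. *)
Definition is_angular_derivative (f : C -> C) (tau l : C) : Prop :=
  forall M : R, 1 < M ->
    filterlim (fun z => Cdiv (Cminus (f z) tau) (Cminus z tau))
      (within (Stolz_region tau M) (@locally C_UniformSpace tau))
      (@locally C_UniformSpace l).

Definition parabolic (f : C -> C) : Prop :=
  holomorphic_self_map f /\
  exists tau : C,
    Cmod tau = 1 /\ is_Denjoy_Wolff_point f tau /\
    is_angular_derivative f tau (RtoC 1).

Definition positive_hyperbolic_step (f : C -> C) : Prop :=
  exists (z0 : C) (l : R),
    unit_disc z0 /\ 0 < l /\
    is_lim_seq
      (fun n => hyperbolic_dist (iterate f n z0) (iterate f (S n) z0)) l.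

Definition centralizer (phi psi : C -> C) : Prop :=
  holomorphic_self_map psi /\
  forall z, unit_disc z -> psi (phi z) = phi (psi z).

Definition connected_set (V : C -> Prop) : Prop :=
  forall A B : C -> Prop,
    @open C_UniformSpace A -> @open C_UniformSpace B ->
    (forall z, V z -> A z \/ B z) ->
    (exists z, V z /\ A z) -> (exists z, V z /\ B z) ->
    exists z, V z /\ A z /\ B z.

Definition domain (V : C -> Prop) : Prop :=
  @open C_UniformSpace V /\ (exists z, V z) /\ connected_set V.

Definition absorbing (f : C -> C) (V : C -> Prop) : Prop :=
  domain V /\ (forall z, V z -> unit_disc z) /\ maps_to V V f /\
  forall z, unit_disc z -> exists n : nat, V (iterate f n z).

Definition injective_on (V : C -> Prop) (f : C -> C) : Prop :=
  forall z w, V z -> V w -> f z = f w -> z = w.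

Record canonical_model (phi : C -> C) (S : C -> Prop) (h : C -> C) : Prop := {
  cm_half_plane : S = upper_half_plane \/ S = lower_half_plane;
  cm_holomorphic : holomorphic_on unit_disc h;
  cm_maps_to : maps_to unit_disc S h;
  cm_semiconj : forall z, unit_disc z -> h (phi z) = Cplus (h z) (RtoC 1);
  cm_exhaust : forall w, S w <->
    exists (n : nat) (z : C), unit_disc z /\ w = Cminus (h z) (RtoC (INR n));
  cm_injective : exists V, absorbing phi V /\ injective_on V h;
  cm_normalized : Re (h (RtoC 0)) = 0
}.

(** [c] is the coefficient attached to [phi] and [psi].  Both the canonical
    model [(S, h)] (with [h] restricted to the disc) and [c] are unique when [phi] is parabolic of
    positive hyperbolic step and [psi] lies in its centralizer, so this relation
    is the graph of the partial function [(phi, psi) |-> c]. *)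
Definition is_simultaneous_linearization_coeff
    (phi psi : C -> C) (c : C) : Prop :=
  exists (S : C -> Prop) (h : C -> C),
    canonical_model phi S h /\
    exists beta : C -> C,
      holomorphic_on S beta /\
      (forall w, S w -> beta (Cplus w (RtoC 1)) = Cplus (beta w) (RtoC 1)) /\
      (forall z, unit_disc z ->
         beta (h (phi z)) = Cplus (beta (h z)) (RtoC 1)) /\
      (forall z, unit_disc z -> beta (h (psi z)) = Cplus (beta (h z)) c).

(* Main.v *)
(** Through the model map [h] (composed with [w => - w] if the base space is the
    lower half-plane), [psi] becomes a holomorphic self-map [Psi] of the upper
    half-plane commuting with [w => w + 1], and Schwarz-Pick applied to [w] and
    [w + 1] gives [Im (Psi w) >= Im w].  Equality at one point forces [Psi] to be
    a real translation by [a]; otherwise [Im (Psi w) - Im w] is bounded below on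
    every half-plane [Im w >= y0 > 0].

    In the first case [beta] gives [c = a], and [phi o psi] is semiconjugate to a
    translation by a real [d].  If [d = 0] then [phi o psi] is the identity near a
    point of the absorbing domain, hence everywhere; if [d <> 0] the step is
    bounded below by Schwarz-Pick for [h].

    In the second case [c] is not real, since otherwise [Im beta] would be bounded
    on a high half-plane.  The orbits of [Psi] escape to large height with bounded
    Euclidean steps, hence with hyperbolic steps tending to zero.  Pulling back
    large discs by inverse branches of [h], some
    [rho (phi^k (psi^n z), phi^k (psi^n (phi (psi z))))] is arbitrarily small, and
    [(phi o psi)^m = phi^m o psi^m] contracts it further for [m >= k, n]. *)
Require Import Defs.
From Stdlib Require Import Reals Lra Lia Psatz Classical ClassicalEpsilon.
From Coquelicot Require Import Coquelicot.
Open Scope R_scope.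

(** * Complex derivatives *)

(** All the function theory is drawn from one source, Goursat's theorem on rectangles: it makes the
    mean over a circle independent of the radius, and the mean of a periodic function independent of
    the height. The first fact gives a maximum principle that tolerates one exceptional point, hence
    can be applied to difference quotients. Schwarz's lemma, the open mapping theorem and the
    holomorphy of inverses follow without Cauchy's formula or power series. The second fact is
    behind the lower bound for [Im (Psi w) - Im w]: the function [Psi w - w] is periodic, and
    Schwarz-Pick compares its values at equal height with a constant uniform above [y0]. Since [h]
    need not be injective, [Psi] cannot be defined as a conjugate of [psi] by [h]. A point of the
    half-plane is written as a translate of some [h z] and sent to the same translate of
    [h (psi z)]. This is consistent because points with equal image under [h] merge once their
    orbits under [phi] have entered the absorbing domain. *)

Definition cont_at (f : C -> C) (z : C) : Prop :=
  forall eps, 0 < eps -> exists d, 0 < d /\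
    forall w, Cmod (w - z) < d -> Cmod (f w - f z) < eps.

(** The uniform structure is that of [C_AbsRing], whose balls are the [Cmod] discs; the equivalence
    serves to inherit the rules for sums, products and compositions. *)
Lemma cont_at_continuous f z :
  cont_at f z <->
  @continuous (AbsRing_UniformSpace C_AbsRing) (AbsRing_UniformSpace C_AbsRing) f z.
Proof.
  split.
  - intros H P [e He]. destruct (H e (cond_pos e)) as [d [Hd H']].
    exists (mkposreal d Hd). intros w Hw. apply He, H', Hw.
  - intros H eps He.
    destruct (H (fun y => Cmod (y - f z) < eps)) as [d Hd].
    { exists (mkposreal eps He). intros y Hy. exact Hy. }
    exists d; split; [apply cond_pos|]. intros w Hw. apply Hd, Hw.
Qed.

Lemma cont_at_const a z : cont_at (fun _ => a) z.
Proof. apply cont_at_continuous.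
  exact (@continuous_const (AbsRing_UniformSpace C_AbsRing) (AbsRing_UniformSpace C_AbsRing) a z). Qed.

Lemma cont_at_id z : cont_at (fun w => w) z.
Proof. apply cont_at_continuous.
  exact (@continuous_id (AbsRing_UniformSpace C_AbsRing) z). Qed.

Lemma cont_at_plus f g z :
  cont_at f z -> cont_at g z -> cont_at (fun w => f w + g w)%C z.
Proof.
  rewrite !cont_at_continuous. intros Hf Hg.
  exact (@continuous_plus (AbsRing_UniformSpace C_AbsRing) C_AbsRing
           (AbsRing_NormedModule C_AbsRing) f g z Hf Hg).
Qed.

Lemma cont_at_mult f g z :
  cont_at f z -> cont_at g z -> cont_at (fun w => f w * g w)%C z.
Proof.
  rewrite !cont_at_continuous. intros Hf Hg.
  exact (@continuous_mult (AbsRing_UniformSpace C_AbsRing) C_AbsRing f g z Hf Hg).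
Qed.

Lemma cont_at_comp f g z :
  cont_at g z -> cont_at f (g z) -> cont_at (fun w => f (g w)) z.
Proof. rewrite !cont_at_continuous. intros Hg Hf. 
  exact (@continuous_comp (AbsRing_UniformSpace C_AbsRing) (AbsRing_UniformSpace C_AbsRing)
    (AbsRing_UniformSpace C_AbsRing) g f z Hg Hf). Qed.

Lemma cont_at_minus f g z :
  cont_at f z -> cont_at g z -> cont_at (fun w => f w - g w)%C z.
Proof.
  intros Hf Hg eps He.
  assert (H : cont_at (fun w => f w + (RtoC (-1)) * g w)%C z)
    by (apply cont_at_plus, cont_at_mult; auto using cont_at_const).
  destruct (H eps He) as [d [Hd H']]. exists d; split; [easy|].
  intros w Hw. specialize (H' w Hw).
  replace (f w - g w - (f z - g z))%C
    with (f w + RtoC (-1) * g w - (f z + RtoC (-1) * g z))%C by ring.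
  exact H'.
Qed.

Lemma cont_at_ext_loc f g z r :
  0 < r -> (forall w, Cmod (w - z) < r -> f w = g w) ->
  cont_at f z -> cont_at g z.
Proof.
  intros Hr E H eps He. destruct (H eps He) as [d [Hd H']].
  exists (Rmin d r); split; [now apply Rmin_pos|]. intros w Hw.
  assert (Hz : Cmod (z - z) < r)
    by (replace (z - z)%C with (RtoC 0) by ring; rewrite Cmod_0; easy).
  rewrite <- !E; auto.
  - apply H'. apply Rlt_le_trans with (1 := Hw), Rmin_l.
  - apply Rlt_le_trans with (1 := Hw), Rmin_r.
Qed.

Lemma Cminus_refl (z : C) : (z - z)%C = RtoC 0.
Proof. ring. Qed.

Lemma Cminus_eq_0 (z w : C) : (z - w)%C = RtoC 0 -> z = w.
Proof. intros H. replace z with (z - w + w)%C by ring. rewrite H. ring. Qed.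

Lemma Cmod_sub_sym (z w : C) : Cmod (z - w) = Cmod (w - z).
Proof. rewrite <- Cmod_opp. f_equal. ring. Qed.

Lemma Cmod_triangle_sub (x y z : C) : Cmod (x - z) <= Cmod (x - y) + Cmod (y - z).
Proof. replace (x - z)%C with ((x - y) + (y - z))%C by ring. apply Cmod_triangle. Qed.

Lemma Cmod_sub_ge (x y : C) : Cmod x - Cmod y <= Cmod (x - y).
Proof.
  generalize (Cmod_triangle (x - y) y). replace (x - y + y)%C with x by ring. lra.
Qed.

Lemma Cmod_eq (z w : C) : Cmod (z - w) <= 0 -> z = w.
Proof.
  intros H. apply Cminus_eq_0, Cmod_eq_0. generalize (Cmod_ge_0 (z - w)). lra.
Qed.

Lemma cont_at_neq_0 f z :
  cont_at f z -> f z <> RtoC 0 ->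
  exists d, 0 < d /\ forall w, Cmod (w - z) < d -> Cmod (f z) / 2 < Cmod (f w).
Proof.
  intros H N. apply Cmod_gt_0 in N.
  destruct (H (Cmod (f z) / 2)) as [d [Hd H']]; [lra|].
  exists d; split; [easy|]. intros w Hw. specialize (H' w Hw).
  rewrite Cmod_sub_sym in H'. generalize (Cmod_sub_ge (f z) (f z - f w)).
  replace (f z - (f z - f w))%C with (f w) by ring. lra.
Qed.

Lemma cont_at_inv f z :
  cont_at f z -> f z <> RtoC 0 -> cont_at (fun w => / f w)%C z.
Proof.
  intros H N eps He. destruct (cont_at_neq_0 f z H N) as [d1 [Hd1 H1]].
  pose proof (proj1 (Cmod_gt_0 _) N) as N'.
  set (m := Cmod (f z)) in *.
  destruct (H (eps * (m * m / 2))) as [d2 [Hd2 H2]].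
  { apply Rmult_lt_0_compat; [easy|]. nra. }
  exists (Rmin d1 d2); split; [now apply Rmin_pos|]. intros w Hw.
  assert (W1 := H1 w (Rlt_le_trans _ _ _ Hw (Rmin_l _ _))).
  assert (W2 := H2 w (Rlt_le_trans _ _ _ Hw (Rmin_r _ _))).
  assert (Nw : f w <> RtoC 0) by (apply Cmod_gt_0; lra).
  replace (/ f w - / f z)%C with ((f z - f w) / (f w * f z))%C by (now field).
  rewrite Cmod_div, Cmod_mult, Cmod_sub_sym; [|now apply Cmult_neq_0].
  fold m. apply Rmult_lt_reg_r with (Cmod (f w) * m); [nra|].
  unfold Rdiv. rewrite Rmult_assoc, Rinv_l, Rmult_1_r by nra.
  apply Rlt_le_trans with (1 := W2). apply Rmult_le_compat_l; nra.
Qed.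

Lemma cont_at_div f g z :
  cont_at f z -> cont_at g z -> g z <> RtoC 0 -> cont_at (fun w => f w / g w)%C z.
Proof. intros. apply cont_at_mult; auto using cont_at_inv. Qed.

(* Caratheodory's form of the complex derivative: the slope function [k] is
   continuous at [z]; this makes the differentiation rules purely algebraic. *)
Definition cderiv (f : C -> C) (z l : C) : Prop :=
  exists k, cont_at k z /\ k z = l /\ forall w, (f w - f z = k w * (w - z))%C.

Definition holo (f : C -> C) (z : C) : Prop := exists l, cderiv f z l.

Lemma cderiv_intro f z l :
  (forall eps, 0 < eps -> exists d, 0 < d /\ forall w, Cmod (w - z) < d ->
     Cmod (f w - f z - l * (w - z)) <= eps * Cmod (w - z)) ->
  cderiv f z l.
Proof.
  intros H.
  exists (fun w => if excluded_middle_informative (w = z) then l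
                   else ((f w - f z) / (w - z))%C).
  assert (E : (if excluded_middle_informative (z = z) then l
                   else ((f z - f z) / (z - z))%C) = l)
    by (destruct excluded_middle_informative; tauto).
  repeat split.
  - intros eps He. destruct (H (eps / 2)) as [d [Hd H']]; [lra|].
    exists d; split; [easy|]. intros w Hw. cbv beta. rewrite E.
    destruct (excluded_middle_informative (w = z)) as [->|N].
    + rewrite Cminus_refl, Cmod_0. easy.
    + assert (N' : (w - z)%C <> RtoC 0) by (contradict N; now apply Cminus_eq_0).
      replace ((f w - f z) / (w - z) - l)%C
        with ((f w - f z - l * (w - z)) / (w - z))%C by (now field).
      rewrite Cmod_div by easy. apply Cmod_gt_0 in N'.
      apply Rle_lt_trans with (eps / 2); [|lra].
      apply Rmult_le_reg_r with (Cmod (w - z)); [easy|].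
      unfold Rdiv at 1. rewrite Rmult_assoc, Rinv_l, Rmult_1_r by lra. now apply H'.
  - exact E.
  - intros w. destruct (excluded_middle_informative (w = z)) as [->|N]; [ring|].
    field. contradict N. now apply Cminus_eq_0.
Qed.

Lemma cderiv_elim f z l :
  cderiv f z l ->
  forall eps, 0 < eps -> exists d, 0 < d /\ forall w, Cmod (w - z) < d ->
     Cmod (f w - f z - l * (w - z)) <= eps * Cmod (w - z).
Proof.
  intros [k [Hk [<- E]]] eps He. destruct (Hk eps He) as [d [Hd H]].
  exists d; split; [easy|]. intros w Hw. rewrite E.
  replace (k w * (w - z) - k z * (w - z))%C with ((k w - k z) * (w - z))%C by ring.
  rewrite Cmod_mult. apply Rmult_le_compat_r; [apply Cmod_ge_0|]. now left; apply H.
Qed.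

Lemma holo_of_ex_derive f z : @ex_derive C_AbsRing C_NormedModule f z -> holo f z.
Proof.
  intros [l [_ H]]. exists l. apply cderiv_intro. intros eps He.
  destruct (H z (fun P HP => HP) (mkposreal eps He)) as [d Hd].
  exists d; split; [apply cond_pos|]. intros w Hw. specialize (Hd w Hw).
  rewrite Cmult_comm. exact Hd.
Qed.

Lemma cderiv_cont f z l : cderiv f z l -> cont_at f z.
Proof.
  intros [k [Hk [_ E]]].
  apply (cont_at_ext_loc (fun w => k w * (w - z) + f z)%C f z 1 Rlt_0_1).
  { intros w _. rewrite <- E. ring. }
  apply cont_at_plus, cont_at_const. apply cont_at_mult; [easy|].
  apply cont_at_minus; [apply cont_at_id|apply cont_at_const].
Qed.

Lemma holo_cont f z : holo f z -> cont_at f z.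
Proof. intros [l H]. now apply cderiv_cont with l. Qed.

Lemma holo_ext_loc f g z r :
  0 < r -> (forall w, Cmod (w - z) < r -> f w = g w) -> holo f z -> holo g z.
Proof.
  intros Hr E [l H]. exists l. apply cderiv_intro. intros eps He.
  destruct (cderiv_elim f z l H eps He) as [d [Hd H']].
  exists (Rmin d r); split; [now apply Rmin_pos|]. intros w Hw.
  assert (Hz : Cmod (z - z) < r) by (rewrite Cminus_refl, Cmod_0; easy).
  rewrite <- !E; auto.
  - apply H'. apply Rlt_le_trans with (1 := Hw), Rmin_l.
  - apply Rlt_le_trans with (1 := Hw), Rmin_r.
Qed.

Lemma cderiv_const a z : cderiv (fun _ => a) z (RtoC 0).
Proof. exists (fun _ => RtoC 0). repeat split; [apply cont_at_const|]. intros; ring. Qed.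

Lemma cderiv_id z : cderiv (fun w => w) z (RtoC 1).
Proof. exists (fun _ => RtoC 1). repeat split; [apply cont_at_const|]. intros; ring. Qed.

Lemma holo_const a z : holo (fun _ => a) z.
Proof. eexists; apply cderiv_const. Qed.

Lemma holo_id z : holo (fun w => w) z.
Proof. eexists; apply cderiv_id. Qed.

Lemma holo_plus f g z : holo f z -> holo g z -> holo (fun w => f w + g w)%C z.
Proof.
  intros [l [k [Hk [_ E]]]] [l' [k' [Hk' [_ E']]]]. eexists.
  exists (fun w => k w + k' w)%C. repeat split; [now apply cont_at_plus|].
  intros w. replace (f w + g w - (f z + g z))%C
    with ((f w - f z) + (g w - g z))%C by ring. rewrite E, E'. ring.
Qed.

Lemma holo_minus f g z : holo f z -> holo g z -> holo (fun w => f w - g w)%C z.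
Proof.
  intros [l [k [Hk [_ E]]]] [l' [k' [Hk' [_ E']]]]. eexists.
  exists (fun w => k w - k' w)%C. repeat split; [now apply cont_at_minus|].
  intros w. replace (f w - g w - (f z - g z))%C
    with ((f w - f z) - (g w - g z))%C by ring. rewrite E, E'. ring.
Qed.

Lemma holo_mult f g z : holo f z -> holo g z -> holo (fun w => f w * g w)%C z.
Proof.
  intros [l [k [Hk [_ E]]]] Hg. pose proof (holo_cont _ _ Hg) as Cg.
  destruct Hg as [l' [k' [Hk' [_ E']]]]. eexists.
  exists (fun w => k w * g w + f z * k' w)%C. repeat split.
  - apply cont_at_plus; apply cont_at_mult; auto using cont_at_const.
  - intros w. replace (f w * g w - f z * g z)%C
      with ((f w - f z) * g w + f z * (g w - g z))%C by ring. rewrite E, E'. ring.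
Qed.

Lemma holo_inv f z : holo f z -> f z <> RtoC 0 -> holo (fun w => / f w)%C z.
Proof.
  intros Hf N. pose proof (holo_cont _ _ Hf) as Cf.
  destruct (cont_at_neq_0 f z Cf N) as [d [Hd Hn]].
  assert (Nw : forall w, Cmod (w - z) < d -> f w <> RtoC 0).
  { intros w Hw. apply Cmod_gt_0. specialize (Hn w Hw).
    generalize (Cmod_ge_0 (f z)). lra. }
  destruct Hf as [l [k [Hk [_ E]]]].
  (* The slope identity in [cderiv] is required at every [w], so [/ f] is traded for a function that
     agrees with it near [z] and has the slope [- (k w / (f w * f z))] everywhere. *)
  apply (holo_ext_loc
    (fun w => / f z + (- (k w / (f w * f z))) * (w - z))%C _ z d Hd).
  - intros w Hw. replace (- (k w / (f w * f z)) * (w - z))%C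
      with (- (k w * (w - z)) / (f w * f z))%C
      by (field; split; auto). rewrite <- E. field. split; auto.
  - eexists. exists (fun w => - (k w / (f w * f z)))%C. repeat split.
    + apply (cont_at_ext_loc (fun w => RtoC (-1) * (k w / (f w * f z)))%C _ z 1 Rlt_0_1).
      { intros; ring. }
      apply cont_at_mult; [apply cont_at_const|].
      apply cont_at_div; auto using cont_at_mult, cont_at_const.
      now apply Cmult_neq_0.
    + intros w. ring.
Qed.

Lemma holo_div f g z :
  holo f z -> holo g z -> g z <> RtoC 0 -> holo (fun w => f w / g w)%C z.
Proof. intros. apply holo_mult; auto using holo_inv. Qed.

Lemma cderiv_comp f g z l l' :
  cderiv g z l -> cderiv f (g z) l' -> cderiv (fun w => f (g w)) z (l' * l).
Proof.
  intros Hg [k' [Hk' [<- E']]]. pose proof (cderiv_cont _ _ _ Hg) as Cg.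
  destruct Hg as [k [Hk [<- E]]].
  exists (fun w => k' (g w) * k w)%C. repeat split.
  - apply cont_at_mult; [|easy]. now apply (cont_at_comp k' g z).
  - intros w. rewrite E', E. ring.
Qed.

Lemma holo_comp f g z :
  holo g z -> holo f (g z) -> holo (fun w => f (g w)) z.
Proof. intros [l H] [l' H']. eexists. eapply cderiv_comp; eauto. Qed.

(** Away from [z] the slope is a quotient of holomorphic functions; at [z] it is only known to be
    continuous, and [z] becomes the exceptional point that the maximum principle permits. *)
Lemma cderiv_slope f z l :
  cderiv f z l ->
  exists k, cont_at k z /\ k z = l /\ (forall w, f w - f z = k w * (w - z))%C /\
    (forall w, w <> z -> holo f w -> holo k w).
Proof.
  intros [k [Hk [Ek E]]]. exists k. repeat (split; [easy|]).
  intros w N Hw.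
  assert (N' : (w - z)%C <> RtoC 0) by (contradict N; now apply Cminus_eq_0).
  apply (holo_ext_loc (fun v => (f v - f z) / (v - z))%C k w (Cmod (w - z))).
  - now apply Cmod_gt_0.
  - intros v Hv. rewrite E. field. intros E0. apply Cminus_eq_0 in E0. subst v.
    rewrite Cmod_sub_sym in Hv. lra.
  - apply holo_div; [apply holo_minus|apply holo_minus|];
      auto using holo_const, holo_id.
Qed.

(** * Goursat's theorem on rectangles *)

Lemma nested_point (u v : nat -> R) :
  (forall n, u n <= u (S n)) -> (forall n, v (S n) <= v n) -> (forall n, u n <= v n) ->
  exists x, forall n, u n <= x <= v n.
Proof.
  intros Hu Hv Huv.
  assert (Mu : forall m n, (m <= n)%nat -> u m <= u n).
  { intros m n L. induction L; [lra|]. specialize (Hu m0). lra. }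
  assert (Mv : forall m n, (m <= n)%nat -> v n <= v m).
  { intros m n L. induction L; [lra|]. specialize (Hv m0). lra. }
  assert (X : forall m n, u m <= v n).
  { intros m n. apply Rle_trans with (u (max m n)); [apply Mu; lia|].
    apply Rle_trans with (v (max m n)); [apply Huv|apply Mv; lia]. }
  destruct (completeness (fun x => exists n, x = u n)) as [x [U L]].
  - exists (v 0%nat). intros y [n ->]. apply X.
  - now exists (u 0%nat), 0%nat.
  - exists x. intros n. split; [apply U; now exists n|].
    apply L. intros y [m ->]. apply X.
Qed.

Lemma half_pow_small l d : 0 < d -> exists n, l / 2 ^ n < d.
Proof.
  intros Hd. destruct (Rle_dec l 0) as [H|H].
  { exists 0%nat. simpl. lra. }
  destruct (pow_lt_1_zero (/ 2)) with (y := d / l) as [N HN].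
  - rewrite Rabs_pos_eq; lra.
  - apply Rdiv_lt_0_compat; lra.
  - exists N. specialize (HN N (Nat.le_refl _)).
    assert (P2 : 0 < 2 ^ N) by (apply pow_lt; lra).
    rewrite Rabs_pos_eq in HN by (apply pow_le; lra). rewrite pow_inv in HN.
    apply Rmult_lt_reg_r with (/ l); [apply Rinv_0_lt_compat; lra|].
    replace (l / 2 ^ N * / l) with (/ 2 ^ N) by (field; lra). exact HN.
Qed.

(** A compactness principle: a bad rectangle has a bad quarter, and the nested bad rectangles shrink
    to a point where the local hypothesis is contradicted. It serves for Goursat's theorem, for
    maxima on compact sets and for covering a rectangle by translates of the image of the absorbing
    domain. *)
Lemma bisection (P : R -> R -> R -> R -> Prop) a b c d :
  a <= b -> c <= d ->
  (forall a' b' c' d', a <= a' -> a' <= b' -> b' <= b -> c <= c' -> c' <= d' -> d' <= d ->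
     P a' ((a' + b') / 2) c' ((c' + d') / 2) -> P ((a' + b') / 2) b' c' ((c' + d') / 2) ->
     P a' ((a' + b') / 2) ((c' + d') / 2) d' -> P ((a' + b') / 2) b' ((c' + d') / 2) d' ->
     P a' b' c' d') ->
  (forall x y, a <= x <= b -> c <= y <= d -> exists e, 0 < e /\
     forall a' b' c' d', a <= a' <= x -> x <= b' <= b -> c <= c' <= y -> y <= d' <= d ->
       b' - a' < e -> d' - c' < e -> P a' b' c' d') ->
  P a b c d.
Proof.
  intros Hab Hcd Split Loc. apply NNPP. intros N0.
  pose (Q := fun s : (R * R) * (R * R) => P (fst (fst s)) (snd (fst s)) (fst (snd s)) (snd (snd s))).
  (* A bad quarter is selected; the last one needs no test, because [Split] makes it bad when the
     other three are good. *)
  pose (step := fun s : (R * R) * (R * R) =>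
    let a' := fst (fst s) in let b' := snd (fst s) in
    let c' := fst (snd s) in let d' := snd (snd s) in
    let m := (a' + b') / 2 in let n := (c' + d') / 2 in
    if excluded_middle_informative (~ P a' m c' n) then ((a', m), (c', n)) else
    if excluded_middle_informative (~ P m b' c' n) then ((m, b'), (c', n)) else
    if excluded_middle_informative (~ P a' m n d') then ((a', m), (n, d'))
    else ((m, b'), (n, d'))).
  pose (inv := fun s : (R * R) * (R * R) => ~ Q s /\
    a <= fst (fst s) /\ fst (fst s) <= snd (fst s) /\ snd (fst s) <= b /\
    c <= fst (snd s) /\ fst (snd s) <= snd (snd s) /\ snd (snd s) <= d).
  pose (nice := fun s t : (R * R) * (R * R) =>
    fst (fst s) <= fst (fst t) /\ snd (fst t) <= snd (fst s) /\
    fst (snd s) <= fst (snd t) /\ snd (snd t) <= snd (snd s) /\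
    snd (fst t) - fst (fst t) = (snd (fst s) - fst (fst s)) / 2 /\
    snd (snd t) - fst (snd t) = (snd (snd s) - fst (snd s)) / 2).
  assert (Hstep : forall s, inv s -> inv (step s) /\ nice s (step s)).
  { intros [[a' b'] [c' d']]. unfold inv, nice, Q, step; cbn [fst snd].
    intros [NP H].
    repeat destruct excluded_middle_informative; cbn [fst snd];
      (split; [split; [try assumption|lra]|lra]).
    intros HP. apply NP, Split; try lra; auto; now apply NNPP. }
  pose (s := fun n => Nat.iter n step ((a, b), (c, d))).
  assert (Hs : forall n, inv (s n)).
  { intros n. induction n as [|n IH].
    - unfold s, inv, Q; simpl. split; [assumption|lra].
    - now apply (Hstep (s n)). }
  assert (Ns : forall n, nice (s n) (s (S n))) by (intros n; now apply (Hstep (s n))).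
  assert (Len : forall n, snd (fst (s n)) - fst (fst (s n)) = (b - a) / 2 ^ n /\
                          snd (snd (s n)) - fst (snd (s n)) = (d - c) / 2 ^ n).
  { induction n as [|n IH]; [simpl; split; lra|].
    destruct (Ns n) as (_ & _ & _ & _ & -> & ->). destruct IH as [-> ->].
    simpl. split; field; apply pow_nonzero; lra. }
  destruct (nested_point (fun n => fst (fst (s n))) (fun n => snd (fst (s n)))) as [x Hx].
  1, 2: intros n; destruct (Ns n); lra.
  { intros n; destruct (Hs n); lra. }
  destruct (nested_point (fun n => fst (snd (s n))) (fun n => snd (snd (s n)))) as [y Hy].
  1, 2: intros n; destruct (Ns n); lra.
  { intros n; destruct (Hs n); lra. }
  destruct (Loc x y) as [e [He Hloc]]; [apply (Hx 0%nat)|apply (Hy 0%nat)|].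
  destruct (half_pow_small (b - a) e He) as [n1 H1].
  destruct (half_pow_small (d - c) e He) as [n2 H2].
  assert (Mono : forall l m n, 0 <= l -> (m <= n)%nat -> l / 2 ^ n <= l / 2 ^ m).
  { intros l m n Hl L. apply Rmult_le_compat_l; [easy|].
    apply Rinv_le_contravar; [apply pow_lt; lra|]. apply Rle_pow; [lra|easy]. }
  set (n := max n1 n2).
  assert (L1 := Mono (b - a) n1 n ltac:(lra) ltac:(lia)).
  assert (L2 := Mono (d - c) n2 n ltac:(lra) ltac:(lia)).
  destruct (Hs n) as [NQ HB]. destruct (Len n) as [E1 E2].
  specialize (Hx n). specialize (Hy n). cbv beta in Hx, Hy.
  apply NQ. unfold Q. apply Hloc; lra.
Qed.

Lemma Rabs_Im_le z : Rabs (Im z) <= Cmod z.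
Proof. eapply Rle_trans; [|apply Rmax_Cmod]. apply Rmax_r. Qed.

Lemma Cmod_le_Re_Im z : Cmod z <= Rabs (Re z) + Rabs (Im z).
Proof.
  apply Rsqr_incr_0_var; [|generalize (Rabs_pos (Re z)) (Rabs_pos (Im z)); lra].
  rewrite !Rsqr_pow2, Cmod2_alt, <- (pow2_abs (Re z)), <- (pow2_abs (Im z)).
  generalize (Rabs_pos (Re z)) (Rabs_pos (Im z)). nra.
Qed.

Lemma continuous_Re_along (f : C -> C) (g : R -> C) t :
  cont_at f (g t) ->
  (forall eps, 0 < eps -> exists d, 0 < d /\ forall s, Rabs (s - t) < d -> Cmod (g s - g t) < eps) ->
  continuous (fun s => Re (f (g s))) t.
Proof.
  intros Hf Hg P [e He]. destruct (Hf e (cond_pos e)) as [d1 [Hd1 H1]].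
  destruct (Hg d1 Hd1) as [d2 [Hd2 H2]].
  exists (mkposreal d2 Hd2). intros s Hs. apply He.
  change (Rabs (Re (f (g s)) - Re (f (g t))) < e).
  eapply Rle_lt_trans; [|apply H1, H2, Hs].
  eapply Rle_trans; [|apply re_le_Cmod]. right. reflexivity.
Qed.

Lemma Im_Re_mul z : Im z = Re (- Ci * z)%C.
Proof. destruct z; simpl. ring. Qed.

Lemma cont_path_h y t eps :
  0 < eps -> exists d, 0 < d /\ forall s, Rabs (s - t) < d -> Cmod ((s, y) - (t, y))%C < eps.
Proof.
  intros He. exists eps; split; [easy|]. intros s Hs.
  eapply Rle_lt_trans; [apply Cmod_le_Re_Im|]. simpl.
  replace (y + - y) with 0 by ring. rewrite Rabs_R0, Rplus_0_r. exact Hs.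
Qed.

Lemma cont_path_v x t eps :
  0 < eps -> exists d, 0 < d /\ forall s, Rabs (s - t) < d -> Cmod ((x, s) - (x, t))%C < eps.
Proof.
  intros He. exists eps; split; [easy|]. intros s Hs.
  eapply Rle_lt_trans; [apply Cmod_le_Re_Im|]. simpl.
  replace (x + - x) with 0 by ring. rewrite Rabs_R0, Rplus_0_l. exact Hs.
Qed.

Lemma continuous_Re_h f x y : cont_at f (x, y) -> continuous (fun s => Re (f (s, y))) x.
Proof.
  intros H. apply (continuous_Re_along f (fun s => (s, y)) x H). apply cont_path_h.
Qed.

Lemma continuous_Im_v f x y : cont_at f (x, y) -> continuous (fun s => Im (f (x, s))) y.
Proof.
  intros H. apply continuous_ext with (fun s => Re (- Ci * f (x, s))%C).
  { intros s. now rewrite <- Im_Re_mul. }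
  apply (continuous_Re_along (fun w => - Ci * f w)%C (fun s => (x, s)) y).
  - apply cont_at_mult; [apply cont_at_const|easy].
  - apply cont_path_v.
Qed.

Lemma ex_RInt_Re_h f a b y :
  a <= b -> (forall x, a <= x <= b -> cont_at f (x, y)) ->
  ex_RInt (fun x => Re (f (x, y))) a b.
Proof.
  intros L H. apply @ex_RInt_continuous. rewrite Rmin_left, Rmax_right by easy.
  intros x Hx. now apply continuous_Re_h, H.
Qed.

Lemma ex_RInt_Im_v f x c d :
  c <= d -> (forall y, c <= y <= d -> cont_at f (x, y)) ->
  ex_RInt (fun y => Im (f (x, y))) c d.
Proof.
  intros L H. apply @ex_RInt_continuous. rewrite Rmin_left, Rmax_right by easy.
  intros y Hy. now apply continuous_Im_v, H.
Qed.

(* Real part of the integral of [f] over the boundary of [[a,b] x [c,d]]. *)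
Definition rect_int (f : C -> C) (a b c d : R) : R :=
  RInt (fun x => Re (f (x, c))) a b - RInt (fun x => Re (f (x, d))) a b
  - (RInt (fun y => Im (f (b, y))) c d - RInt (fun y => Im (f (a, y))) c d).

Lemma rect_int_quarter f a b c d m n :
  a <= m <= b -> c <= n <= d ->
  (forall x y, a <= x <= b -> c <= y <= d -> cont_at f (x, y)) ->
  rect_int f a b c d =
    rect_int f a m c n + rect_int f m b c n + rect_int f a m n d + rect_int f m b n d.
Proof.
  intros Hm Hn H. unfold rect_int.
  assert (X : forall y, c <= y <= d ->
    RInt (fun x => Re (f (x, y))) a b =
    RInt (fun x => Re (f (x, y))) a m + RInt (fun x => Re (f (x, y))) m b).
  { intros y Hy. symmetry. apply (RInt_Chasles (fun x => Re (f (x, y))) a m b);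
      apply ex_RInt_Re_h; try lra; intros x Hx; apply H; lra. }
  assert (Y : forall x, a <= x <= b ->
    RInt (fun y => Im (f (x, y))) c d =
    RInt (fun y => Im (f (x, y))) c n + RInt (fun y => Im (f (x, y))) n d).
  { intros x Hx. symmetry. apply (RInt_Chasles (fun y => Im (f (x, y))) c n d);
      apply ex_RInt_Im_v; try lra; intros y Hy; apply H; lra. }
  rewrite (X c), (X d), (Y a), (Y b) by lra. ring.
Qed.

Lemma Cmod_rect_le x y x' y' : Cmod ((x, y) - (x', y'))%C <= Rabs (x - x') + Rabs (y - y').
Proof. apply (Cmod_le_Re_Im ((x, y) - (x', y'))%C). Qed.

Lemma RInt_diff_bound (g h : R -> R) a b K e :
  a <= b -> ex_RInt g a b -> ex_RInt h a b ->
  (forall x, a <= x <= b -> Rabs (g x - h x - K) <= e) ->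
  Rabs (RInt g a b - RInt h a b - K * (b - a)) <= e * (b - a).
Proof.
  intros L Hg Hh H.
  assert (E1 : ex_RInt (fun x => minus (g x) (h x)) a b) by (apply @ex_RInt_minus; auto).
  assert (E : RInt (fun x => minus (minus (g x) (h x)) K) a b
              = RInt g a b - RInt h a b - K * (b - a)).
  { rewrite (RInt_minus (V := R_CompleteNormedModule) (fun x => minus (g x) (h x)) (fun _ => K))
      by (auto using ex_RInt_const).
    rewrite (RInt_minus (V := R_CompleteNormedModule) g h), RInt_const by auto.
    unfold minus, plus, opp, scal; simpl. unfold mult; simpl. ring. }
  rewrite <- E, Rmult_comm. apply abs_RInt_le_const; auto.
  apply @ex_RInt_minus; auto using ex_RInt_const.
Qed.

(** The affine part of [f] at [(x, y)] contributes nothing: the horizontal sides give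
    [Im l * (d - c) * (b - a)], the vertical sides the same, and the two cancel. Only the remainder,
    of size [eps] times the side lengths, is left. *)
Lemma rect_int_local f x y :
  holo f (x, y) -> forall eps, 0 < eps -> exists e, 0 < e /\
    forall a b c d, a <= x <= b -> c <= y <= d -> b - a < e -> d - c < e ->
      (forall s t, a <= s <= b -> c <= t <= d -> cont_at f (s, t)) ->
      Rabs (rect_int f a b c d) <= eps * ((b - a) ^ 2 + (d - c) ^ 2).
Proof.
  intros [l H] eps He.
  destruct (cderiv_elim f _ l H (eps / 8)) as [e [He' Hd]]; [lra|].
  exists (e / 2); split; [lra|]. intros a b c d Hx Hy La Lc Hc.
  set (L := (b - a) + (d - c)).
  assert (B : forall s t, a <= s <= b -> c <= t <= d ->
     Cmod (f (s, t) - f (x, y) - l * ((s, t) - (x, y))) <= eps / 8 * L).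
  { intros s t Hs Ht.
    assert (D : Cmod ((s, t) - (x, y))%C <= L).
    { eapply Rle_trans; [apply Cmod_rect_le|].
      assert (Rabs (s - x) <= b - a) by (apply Rabs_le; lra).
      assert (Rabs (t - y) <= d - c) by (apply Rabs_le; lra). unfold L; lra. }
    eapply Rle_trans; [apply Hd; unfold L in D; lra|].
    apply Rmult_le_compat_l; lra. }
  assert (B2 : forall s t s' t', a <= s <= b -> c <= t <= d -> a <= s' <= b -> c <= t' <= d ->
     Cmod (f (s, t) - f (s', t') - l * ((s, t) - (s', t'))) <= eps / 4 * L).
  { intros s t s' t' Hs Ht Hs' Ht'.
    replace (f (s, t) - f (s', t') - l * ((s, t) - (s', t')))%C with
      ((f (s, t) - f (x, y) - l * ((s, t) - (x, y))) -
       (f (s', t') - f (x, y) - l * ((s', t') - (x, y))))%C by ring.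
    eapply Rle_trans; [apply Cmod_triangle|]. rewrite Cmod_opp.
    specialize (B s t Hs Ht) as B1. specialize (B s' t' Hs' Ht') as B1'. lra. }
  assert (H1 : Rabs (RInt (fun s => Re (f (s, c))) a b - RInt (fun s => Re (f (s, d))) a b
                     - (Im l * (d - c)) * (b - a)) <= eps / 4 * L * (b - a)).
  { apply RInt_diff_bound; [lra| | |].
    1, 2: apply ex_RInt_Re_h; [lra|]; intros; apply Hc; lra.
    intros s Hs. eapply Rle_trans; [|apply (B2 s c s d); lra].
    eapply Rle_trans; [|apply re_le_Cmod]. right. f_equal.
    unfold Re, Im; simpl. ring. }
  assert (H2 : Rabs (RInt (fun t => Im (f (b, t))) c d - RInt (fun t => Im (f (a, t))) c d
                     - (Im l * (b - a)) * (d - c)) <= eps / 4 * L * (d - c)).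
  { apply RInt_diff_bound; [lra| | |].
    1, 2: apply ex_RInt_Im_v; [lra|]; intros; apply Hc; lra.
    intros t Ht. eapply Rle_trans; [|apply (B2 b t a t); lra].
    eapply Rle_trans; [|apply Rabs_Im_le]. right. f_equal.
    unfold Re, Im; simpl. ring. }
  unfold rect_int.
  replace (RInt (fun x => Re (f (x, c))) a b - RInt (fun x => Re (f (x, d))) a b -
    (RInt (fun y => Im (f (b, y))) c d - RInt (fun y => Im (f (a, y))) c d)) with
    ((RInt (fun s => Re (f (s, c))) a b - RInt (fun s => Re (f (s, d))) a b
                     - (Im l * (d - c)) * (b - a)) -
     (RInt (fun t => Im (f (b, t))) c d - RInt (fun t => Im (f (a, t))) c d
                     - (Im l * (b - a)) * (d - c))) by ring.
  eapply Rle_trans; [apply Rabs_triang|]. rewrite Rabs_Ropp.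
  apply Rle_trans with (eps / 4 * L * (b - a) + eps / 4 * L * (d - c)); [lra|].
  replace (eps / 4 * L * (b - a) + eps / 4 * L * (d - c)) with (eps * (L ^ 2 / 4))
    by (unfold L; field).
  apply Rmult_le_compat_l; [lra|].
  unfold L. generalize (pow2_ge_0 ((b - a) - (d - c))). nra.
Qed.

(** The bound [eps * ((b - a) ^ 2 + (d - c) ^ 2)] passes from the quarters to the whole without
    loss, since the four quarter bounds add up to it exactly; bisection therefore gives it for every
    [eps]. *)
Theorem goursat f a b c d :
  a <= b -> c <= d ->
  (forall x y, a <= x <= b -> c <= y <= d -> holo f (x, y)) ->
  rect_int f a b c d = 0.
Proof.
  intros Hab Hcd H.
  assert (Hc : forall x y, a <= x <= b -> c <= y <= d -> cont_at f (x, y))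
    by (intros; now apply holo_cont, H).
  assert (B : forall eps, 0 < eps ->
    Rabs (rect_int f a b c d) <= eps * ((b - a) ^ 2 + (d - c) ^ 2)).
  { intros eps He.
    apply (bisection (fun a b c d =>
      Rabs (rect_int f a b c d) <= eps * ((b - a) ^ 2 + (d - c) ^ 2))); auto.
    - intros a' b' c' d' Ha1 Ha2 Ha3 Hc1 Hc2 Hc3 Q1 Q2 Q3 Q4.
      rewrite (rect_int_quarter f a' b' c' d' ((a' + b') / 2) ((c' + d') / 2));
        [|lra|lra|intros; apply Hc; lra].
      eapply Rle_trans; [apply Rabs_triang|].
      eapply Rle_trans; [apply Rplus_le_compat_r, Rabs_triang|].
      eapply Rle_trans; [do 2 apply Rplus_le_compat_r; apply Rabs_triang|].
      nra.
    - intros x y Hx Hy. destruct (rect_int_local f x y (H x y Hx Hy) eps He) as [e [He' Q]].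
      exists e; split; [easy|]. intros. apply Q; try lra. intros; apply Hc; lra. }
  set (A := (b - a) ^ 2 + (d - c) ^ 2) in *.
  assert (HA : 0 <= A) by (unfold A; nra).
  destruct (Req_dec (rect_int f a b c d) 0) as [E|N]; [easy|exfalso].
  apply Rabs_pos_lt in N. set (J := Rabs (rect_int f a b c d)) in *.
  specialize (B (J / (2 * (A + 1)))).
  assert (P : 0 < J / (2 * (A + 1))) by (apply Rdiv_lt_0_compat; lra).
  specialize (B P).
  assert (E : J / (2 * (A + 1)) * (2 * (A + 1)) = J) by (field; lra). nra.
Qed.

(** * The maximum principle *)

(** In Goursat's theorem the two horizontal sides cancel because [g] agrees on them. After a change
    of variable this gives constancy of means over circles and over periods. *)
Lemma strip_mean_const g a b T :
  a <= b -> 0 <= T ->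
  (forall z, a <= Re z <= b -> holo g z) ->
  (forall s, a <= s <= b -> g (s, T) = g (s, 0)) ->
  RInt (fun t => Im (g (b, t))) 0 T = RInt (fun t => Im (g (a, t))) 0 T.
Proof.
  intros Hab HT H E.
  assert (G : rect_int g a b 0 T = 0).
  { apply goursat; [easy|easy|]. intros x y Hx _. now apply H. }
  unfold rect_int in G.
  rewrite (RInt_ext (fun x => Re (g (x, 0))) (fun x => Re (g (x, T)))) in G.
  - lra.
  - rewrite Rmin_left, Rmax_right by easy. intros x Hx. rewrite E; [easy|lra].
Qed.

Definition cexp (z : C) : C := (exp (Re z) * cos (Im z), exp (Re z) * sin (Im z)).

Lemma cexp_plus z w : cexp (z + w) = (cexp z * cexp w)%C.
Proof.
  destruct z, w. unfold cexp, Cmult, Re, Im; simpl.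
  rewrite exp_plus, cos_plus, sin_plus. f_equal; ring.
Qed.

Lemma Cmod_cexp z : Cmod (cexp z) = exp (Re z).
Proof.
  unfold Cmod, cexp; simpl fst; simpl snd.
  replace ((exp (Re z) * cos (Im z)) ^ 2 + (exp (Re z) * sin (Im z)) ^ 2)
    with (exp (Re z) ^ 2 * ((sin (Im z))² + (cos (Im z))²)) by (unfold Rsqr; ring).
  rewrite sin2_cos2, Rmult_1_r. apply sqrt_pow2. left; apply exp_pos.
Qed.

Lemma derivable_pt_lim_small f l :
  derivable_pt_lim f 0 l -> forall eps, 0 < eps -> exists d, 0 < d /\
    forall h, Rabs h < d -> Rabs (f h - f 0 - l * h) <= eps * Rabs h.
Proof.
  intros H eps He. destruct (H eps He) as [d Hd]. exists d; split; [apply cond_pos|].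
  intros h Hh. destruct (Req_dec h 0) as [->|N].
  { replace (f 0 - f 0 - l * 0) with 0 by ring. rewrite Rabs_R0. lra. }
  specialize (Hd h N Hh). rewrite Rplus_0_l in Hd.
  replace (f h - f 0 - l * h) with (((f h - f 0) / h - l) * h) by (now field).
  rewrite Rabs_mult. apply Rmult_le_compat_r; [apply Rabs_pos|lra].
Qed.

Lemma cderiv_cexp_0 : cderiv cexp (RtoC 0) (RtoC 1).
Proof.
  apply cderiv_intro. intros eps He.
  (* The real and imaginary errors below are at most [4 * e * m] and [5 * e * m], so any [e] with
     [9 * e <= eps] would do. *)
  set (e := Rmin 1 (eps / 16)).
  assert (He1 : 0 < e) by (apply Rmin_pos; lra).
  assert (He2 : e <= eps / 16) by apply Rmin_r.
  assert (He3 : e <= 1) by apply Rmin_l.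
  destruct (derivable_pt_lim_small exp 1) with (eps := e) as [d1 [Hd1 H1]]; auto.
  { rewrite <- exp_0. apply derivable_pt_lim_exp. }
  destruct (derivable_pt_lim_small sin 1) with (eps := e) as [d2 [Hd2 H2]]; auto.
  { rewrite <- cos_0. apply derivable_pt_lim_sin. }
  destruct (derivable_pt_lim_small cos 0) with (eps := e) as [d3 [Hd3 H3]]; auto.
  { replace 0 with (- sin 0) at 2 by (rewrite sin_0; ring). apply derivable_pt_lim_cos. }
  set (d := Rmin (Rmin d1 d2) (Rmin d3 (Rmin 1 e))).
  assert (Hd : 0 < d) by (repeat apply Rmin_pos; lra).
  exists d; split; [easy|]. intros w Hw.
  assert (D1 : d <= d1) by (eapply Rle_trans; apply Rmin_l).
  assert (D2 : d <= d2) by (eapply Rle_trans; [apply Rmin_l|apply Rmin_r]).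
  assert (D3 : d <= d3) by (eapply Rle_trans; [apply Rmin_r|apply Rmin_l]).
  assert (D4 : d <= 1) by (do 2 (eapply Rle_trans; [apply Rmin_r|]); apply Rmin_l).
  assert (D5 : d <= e) by (do 2 (eapply Rle_trans; [apply Rmin_r|]); apply Rmin_r).
  assert (Z : (w - RtoC 0)%C = w) by ring. rewrite Z in *. clear Z.
  generalize (re_le_Cmod w) (Rabs_Im_le w). destruct w as [x y].
  unfold Re, Im; simpl fst; simpl snd. intros Lx Ly.
  set (m := Cmod (x, y)) in *.
  specialize (H1 x ltac:(lra)). specialize (H2 y ltac:(lra)). specialize (H3 y ltac:(lra)).
  rewrite exp_0 in H1. rewrite sin_0 in H2. rewrite cos_0 in H3.
  replace (sin y - 0 - 1 * y) with (sin y - y) in H2 by ring.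
  replace (cos y - 1 - 0 * y) with (cos y - 1) in H3 by ring.
  assert (X3 : 0 < exp x <= 3).
  { split; [apply exp_pos|]. eapply Rle_trans; [|apply exp_le_3].
    destruct (Rle_lt_or_eq_dec x 1) as [h|h].
    - apply Rle_trans with (1 := Rle_abs x). lra.
    - left. now apply exp_increasing.
    - rewrite h. lra. }
  assert (XE : Rabs (exp x - 1) <= 2 * e).
  { replace (exp x - 1) with ((exp x - 1 - 1 * x) + x) by ring.
    eapply Rle_trans; [apply Rabs_triang|]. generalize (Rabs_pos x). nra. }
  eapply Rle_trans; [apply Cmod_le_Re_Im|]. unfold cexp, Re, Im; simpl.
  replace (exp 0) with 1 by (symmetry; apply exp_0).
  rewrite cos_0, sin_0.
  replace (exp x * cos y + - (1 * 1) + - (1 * x - 0 * y)) with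
    ((exp x - 1 - 1 * x) + exp x * (cos y - 1)) by ring.
  replace (exp x * sin y + - (1 * 0) + - (1 * y + 0 * x)) with
    (exp x * (sin y - y) + (exp x - 1) * y) by ring.
  assert (A1 : Rabs ((exp x - 1 - 1 * x) + exp x * (cos y - 1)) <= 4 * e * m).
  { eapply Rle_trans; [apply Rabs_triang|]. rewrite Rabs_mult, (Rabs_pos_eq (exp x)) by lra.
    generalize (Rabs_pos (cos y - 1)) (Rabs_pos x) (Rabs_pos y). intros.
    assert (exp x * Rabs (cos y - 1) <= 3 * (e * m)) by (apply Rmult_le_compat; nra).
    nra. }
  assert (A2 : Rabs (exp x * (sin y - y) + (exp x - 1) * y) <= 5 * e * m).
  { eapply Rle_trans; [apply Rabs_triang|].
    rewrite !Rabs_mult, (Rabs_pos_eq (exp x)) by lra.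
    generalize (Rabs_pos (sin y - y)) (Rabs_pos (exp x - 1)) (Rabs_pos y). intros.
    assert (exp x * Rabs (sin y - y) <= 3 * (e * m)) by (apply Rmult_le_compat; nra).
    assert (Rabs (exp x - 1) * Rabs y <= 2 * e * m) by (apply Rmult_le_compat; nra).
    nra. }
  assert (Hm : 0 <= m) by apply Cmod_ge_0.
  assert (9 * e * m <= eps * m) by (apply Rmult_le_compat_r; lra). lra.
Qed.

Lemma holo_cexp z : holo cexp z.
Proof.
  apply (holo_ext_loc (fun w => cexp z * cexp (w - z))%C cexp z 1 Rlt_0_1).
  { intros w _. rewrite <- cexp_plus. f_equal. ring. }
  apply holo_mult; [apply holo_const|].
  apply (holo_comp cexp (fun w => w - z)%C).
  - apply holo_minus; [apply holo_id|apply holo_const].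
  - rewrite Cminus_refl. eexists; apply cderiv_cexp_0.
Qed.

(* Transporting [f] by [w + cexp] turns circles around [w] into vertical
   segments, so that the mean over a circle does not depend on the radius. *)
Lemma no_strict_peak f z r eta :
  0 < r -> 0 < eta -> cont_at f z ->
  (forall w, w <> z -> Cmod (w - z) <= r -> holo f w) ->
  (forall w, Cmod (w - z) = r -> Re (f w) <= Re (f z) - eta) -> False.
Proof.
  intros Hr He Hc Hh Hpeak.
  destruct (Hc (eta / 2)) as [d [Hd Hd']]; [lra|].
  (* On the circle of radius [r0], continuity keeps [Re f] above [Re (f z) - eta / 2], while on the
     circle of radius [r] it is at most [Re (f z) - eta]; equal means are then impossible. The
     factor [Ci] in [g] turns [Re f] into the imaginary part that [strip_mean_const] integrates. *)
  set (r0 := Rmin r (d / 2)). assert (Hr0 : 0 < r0) by (apply Rmin_pos; lra).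
  assert (Hr0r : r0 <= r) by apply Rmin_l.
  assert (Hr0d : r0 <= d / 2) by apply Rmin_r.
  assert (L : ln r0 <= ln r) by (apply ln_le; lra).
  pose (g := fun w => (Ci * f (z + cexp w))%C).
  assert (M : forall w, Cmod (z + cexp w - z) = exp (Re w)).
  { intros w. rewrite <- Cmod_cexp. f_equal. ring. }
  assert (Hg : forall w, ln r0 <= Re w <= ln r -> holo g w).
  { intros w Hw. apply holo_mult; [apply holo_const|].
    apply (holo_comp f (fun w => z + cexp w)%C).
    - apply holo_plus; [apply holo_const|apply holo_cexp].
    - apply Hh.
      + intros E. assert (X := M w). rewrite E, Cminus_refl, Cmod_0 in X.
        generalize (exp_pos (Re w)). lra.
      + rewrite M, <- (exp_ln r Hr). destruct (proj2 Hw) as [h|h].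
        * left. now apply exp_increasing.
        * rewrite h. lra. }
  assert (P : 0 < 2 * PI) by (generalize PI_RGT_0; lra).
  assert (I := strip_mean_const g (ln r0) (ln r) (2 * PI) L ltac:(lra) Hg).
  assert (E : forall w, Im (g w) = Re (f (z + cexp w)%C)).
  { intros w. unfold g. destruct (f (z + cexp w)%C). simpl. ring. }
  assert (Iex : forall s, ln r0 <= s <= ln r -> ex_RInt (fun t => Im (g (s, t))) 0 (2 * PI)).
  { intros s Hs. apply ex_RInt_Im_v; [lra|]. intros. now apply holo_cont, Hg. }
  assert (U : RInt (fun t => Im (g (ln r, t))) 0 (2 * PI) <= (2 * PI) * (Re (f z) - eta)).
  { replace ((2 * PI) * (Re (f z) - eta)) with (RInt (fun _ => Re (f z) - eta) 0 (2 * PI))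
      by (rewrite RInt_const; unfold scal; simpl; unfold mult; simpl; ring).
    apply RInt_le; [lra|apply Iex; lra|apply ex_RInt_const|].
    intros t _. rewrite E. apply Hpeak. rewrite M. simpl. now apply exp_ln. }
  assert (V : (2 * PI) * (Re (f z) - eta / 2) <= RInt (fun t => Im (g (ln r0, t))) 0 (2 * PI)).
  { replace ((2 * PI) * (Re (f z) - eta / 2)) with (RInt (fun _ => Re (f z) - eta / 2) 0 (2 * PI))
      by (rewrite RInt_const; unfold scal; simpl; unfold mult; simpl; ring).
    apply RInt_le; [lra|apply ex_RInt_const|apply Iex; lra|].
    intros t _. rewrite E.
    assert (X : Cmod (f (z + cexp (ln r0, t))%C - f z) < eta / 2).
    { apply Hd'. rewrite M. simpl. rewrite exp_ln; lra. }
    assert (Y := Rle_lt_trans _ _ _ (re_le_Cmod _) X).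
    apply Rabs_lt_between in Y. unfold Re in *; simpl in Y. lra. }
  rewrite I in U. nra.
  intros s _. unfold g, cexp; simpl. now rewrite cos_2PI, sin_2PI, cos_0, sin_0.
Qed.

Lemma cont_at_conj z : cont_at Cconj z.
Proof.
  intros eps He. exists eps; split; [easy|]. intros w Hw.
  now rewrite <- Cminus_conj, Cmod_conj.
Qed.

Lemma Cmod_sqr_re z : Re (z * Cconj z) = Cmod z ^ 2.
Proof. rewrite Cmod2_alt. destruct z; simpl; ring. Qed.

(** Without a maximum, each point of [K] has a neighbourhood on which [F] is dominated by its value
    at some point of [K]. The best of four dominating points serves a union of four rectangles, so
    bisection yields one point dominating all of [K], itself included. *)
Lemma compact_max (K : C -> Prop) (F : C -> C) a b c d :
  (forall z, K z -> a <= Re z <= b /\ c <= Im z <= d) ->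
  (forall z, ~ K z -> exists r, 0 < r /\ forall w, Cmod (w - z) < r -> ~ K w) ->
  (exists z, K z) -> (forall z, K z -> cont_at F z) ->
  exists z, K z /\ forall w, K w -> Re (F w) <= Re (F z).
Proof.
  intros Box Closed [k0 Hk0] Cont. apply NNPP. intros N.
  assert (Higher : forall z, K z -> exists z', K z' /\ Re (F z) < Re (F z')).
  { intros z Hz. apply NNPP. intros N'. apply N. exists z; split; [easy|].
    intros w Hw. apply Rnot_lt_le. intros L. apply N'. now exists w. }
  enough (Q : exists z', K z' /\ forall z, K z -> a <= Re z <= b -> c <= Im z <= d ->
              Re (F z) < Re (F z')).
  { destruct Q as [z' [Kz' Q]]. destruct (Box z' Kz').
    specialize (Q z' Kz' ltac:(easy) ltac:(easy)). lra. }
  destruct (Box k0 Hk0).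
  apply (bisection (fun a b c d => exists z', K z' /\ forall z, K z ->
     a <= Re z <= b -> c <= Im z <= d -> Re (F z) < Re (F z'))); [lra|lra| |].
  - intros a' b' c' d' _ _ _ _ _ _ [z1 [K1 H1]] [z2 [K2 H2]] [z3 [K3 H3]] [z4 [K4 H4]].
    assert (T : forall p q, K p -> K q -> exists m, K m /\ Re (F p) <= Re (F m) /\ Re (F q) <= Re (F m)).
    { intros p q Kp Kq. destruct (Rle_dec (Re (F p)) (Re (F q))).
      - exists q. repeat split; auto; lra.
      - exists p. repeat split; auto; lra. }
    destruct (T z1 z2 K1 K2) as [p [Kp [P1 P2]]]. destruct (T z3 z4 K3 K4) as [q [Kq [Q1 Q2]]].
    destruct (T p q Kp Kq) as [m [Km [M1 M2]]]. exists m; split; [easy|].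
    intros z Kz Hx Hy.
    destruct (Rle_dec (Re z) ((a' + b') / 2)); destruct (Rle_dec (Im z) ((c' + d') / 2)).
    + specialize (H1 z Kz ltac:(lra) ltac:(lra)). lra.
    + specialize (H3 z Kz ltac:(lra) ltac:(lra)). lra.
    + specialize (H2 z Kz ltac:(lra) ltac:(lra)). lra.
    + specialize (H4 z Kz ltac:(lra) ltac:(lra)). lra.
  - intros x y Hx Hy.
    assert (Loc : exists r z', 0 < r /\ K z' /\
       forall w, K w -> Cmod (w - (x, y)) < r -> Re (F w) < Re (F z')).
    { destruct (classic (K (x, y))) as [Kz|NK].
      - destruct (Higher _ Kz) as [z' [Kz' L]].
        destruct (Cont _ Kz (Re (F z') - Re (F (x, y)))) as [r [Hr H']]; [lra|].
        exists r, z'. repeat split; auto. intros w _ Hw. specialize (H' w Hw).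
        assert (Y := Rle_lt_trans _ _ _ (re_le_Cmod _) H').
        apply Rabs_lt_between in Y. unfold Re in *; simpl in Y. lra.
      - destruct (Closed _ NK) as [r [Hr H']]. exists r, k0. repeat split; auto.
        intros w Kw Hw. now elim (H' w Hw). }
    destruct Loc as [r [z' [Hr [Kz' L]]]]. exists (r / 2); split; [lra|].
    intros a' b' c' d' Ha Hb Hc Hd L1 L2. exists z'; split; [easy|].
    intros [s t] Kz Hs Ht. apply L; [easy|].
    eapply Rle_lt_trans; [apply Cmod_rect_le|]. simpl in Hs, Ht.
    assert (Rabs (s - x) < r / 2) by (apply Rabs_lt_between; lra).
    assert (Rabs (t - y) < r / 2) by (apply Rabs_lt_between; lra). lra.
Qed.

Lemma Cmod_box z z0 R : Cmod (z - z0) <= R ->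
  Re z0 - R <= Re z <= Re z0 + R /\ Im z0 - R <= Im z <= Im z0 + R.
Proof.
  intros H.
  assert (X := Rle_trans _ _ _ (re_le_Cmod _) H).
  assert (Y := Rle_trans _ _ _ (Rabs_Im_le _) H).
  apply Rabs_le_between in X. apply Rabs_le_between in Y.
  unfold Re, Im in *; simpl in X, Y. lra.
Qed.

Lemma disc_max F z0 R :
  0 <= R -> (forall z, Cmod (z - z0) <= R -> cont_at F z) ->
  exists z, Cmod (z - z0) <= R /\ forall w, Cmod (w - z0) <= R -> Re (F w) <= Re (F z).
Proof.
  intros HR HF.
  apply (compact_max (fun z => Cmod (z - z0) <= R) F (Re z0 - R) (Re z0 + R)
          (Im z0 - R) (Im z0 + R)); auto.
  - intros z Hz. now apply Cmod_box.
  - intros z Hz. exists (Cmod (z - z0) - R); split; [lra|]. intros w Hw.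
    generalize (Cmod_triangle_sub z w z0). rewrite (Cmod_sub_sym z w). lra.
  - exists z0. rewrite Cminus_refl, Cmod_0. lra.
Qed.

Lemma circle_max F z0 R :
  0 <= R -> (forall z, Cmod (z - z0) = R -> cont_at F z) ->
  exists z, Cmod (z - z0) = R /\ forall w, Cmod (w - z0) = R -> Re (F w) <= Re (F z).
Proof.
  intros HR HF.
  apply (compact_max (fun z => Cmod (z - z0) = R) F (Re z0 - R) (Re z0 + R)
          (Im z0 - R) (Im z0 + R)); auto.
  - intros z Hz. apply Cmod_box. lra.
  - intros z Hz. exists (Rabs (Cmod (z - z0) - R)); split; [apply Rabs_pos_lt; lra|].
    intros w Hw E. rewrite <- E in Hw.
    generalize (Cmod_triangle_sub z w z0) (Cmod_triangle_sub w z z0).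
    rewrite (Cmod_sub_sym z w). revert Hw. unfold Rabs. destruct Rcase_abs; lra.
  - exists (z0 + RtoC R)%C. replace (z0 + RtoC R - z0)%C with (RtoC R) by ring.
    rewrite Cmod_R. now apply Rabs_pos_eq.
Qed.

(* An isolated point [b] where [f] is merely continuous is allowed: this stands
   in for the removability of the singularity of difference quotients. *)
Theorem max_principle_Re f z0 R M b :
  0 < R ->
  (forall z, Cmod (z - z0) <= R -> cont_at f z) ->
  (forall z, z <> b -> Cmod (z - z0) < R -> holo f z) ->
  (forall z, Cmod (z - z0) = R -> Re (f z) <= M) ->
  forall z, Cmod (z - z0) <= R -> Re (f z) <= M.
Proof.
  intros HR Hc Hh HM z Hz. apply Rnot_lt_le. intros L.
  set (e := (Re (f z) - M) / (2 * R ^ 2)).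
  assert (HR2 : 0 < R ^ 2) by nra.
  assert (He : 0 < e) by (apply Rdiv_lt_0_compat; nra).
  assert (Ee : e * R ^ 2 = (Re (f z) - M) / 2) by (unfold e; field; lra).
  (* The added term equals half of the excess [Re (f z) - M] on the boundary circle: too little to
     move the maximum of [F] there, yet enough to make the interior maximum a strict peak. *)
  pose (F := fun w => (f w + RtoC e * ((w - z0) * Cconj (w - z0)))%C).
  assert (FE : forall w, Re (F w) = Re (f w) + e * Cmod (w - z0) ^ 2).
  { intros w. unfold F. rewrite <- Cmod_sqr_re.
    destruct (f w), ((w - z0) * Cconj (w - z0))%C. simpl. ring. }
  destruct (disc_max F z0 R) as [p [Hp Mp]]; [lra| |].
  { intros w Hw. apply cont_at_plus; [now apply Hc|].
    apply cont_at_mult; [apply cont_at_const|].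
    assert (D : cont_at (fun w => w - z0)%C w)
      by (apply cont_at_minus; auto using cont_at_id, cont_at_const).
    apply cont_at_mult; [easy|]. apply (cont_at_comp Cconj (fun w => w - z0)%C); auto using cont_at_conj. }
  assert (Lp : Cmod (p - z0) < R).
  { destruct Hp as [|E]; [easy|]. specialize (Mp z Hz). rewrite !FE, E in Mp.
    specialize (HM p E). generalize (pow2_ge_0 (Cmod (z - z0))). nra. }
  (* [no_strict_peak] excuses only the centre of its disc, so the disc about [p] must avoid [b]
     unless [b] is its centre. *)
  assert (HrE : exists r, 0 < r /\ r < R - Cmod (p - z0) /\ (p = b \/ r < Cmod (p - b))).
  { destruct (classic (p = b)) as [E|N].
    - exists ((R - Cmod (p - z0)) / 2). repeat split; try lra. now left.
    - assert (0 < Cmod (p - b)) by (apply Cmod_gt_0; contradict N; now apply Cminus_eq_0).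
      exists (Rmin ((R - Cmod (p - z0)) / 2) (Cmod (p - b) / 2)).
      generalize (Rmin_l ((R - Cmod (p - z0)) / 2) (Cmod (p - b) / 2))
        (Rmin_r ((R - Cmod (p - z0)) / 2) (Cmod (p - b) / 2)).
      repeat split; try lra. apply Rmin_pos; lra. }
  destruct HrE as [r [Hr [Hr1 Hr2]]].
  assert (In : forall w, Cmod (w - p) <= r -> Cmod (w - z0) < R).
  { intros w Hw. generalize (Cmod_triangle_sub w p z0). lra. }
  (* [|w - z0|^2] is the real part of a holomorphic function plus [|w - p|^2] *)
  apply (no_strict_peak (fun w => f w + RtoC (2 * e) * (Cconj (p - z0) * (w - p)))%C
           p r (e * r ^ 2)); auto.
  - apply Rmult_lt_0_compat; [easy|now apply pow_lt].
  - apply cont_at_plus; [apply Hc; lra|]. apply holo_cont.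
    repeat apply holo_mult; try apply holo_const. apply holo_minus; auto using holo_const, holo_id.
  - intros w N Hw. apply holo_plus.
    + apply Hh; [|now apply In]. intros ->. destruct Hr2 as [->|Hr2]; [easy|].
      rewrite Cmod_sub_sym in Hw. lra.
    + repeat apply holo_mult; try apply holo_const. apply holo_minus; auto using holo_const, holo_id.
  - intros w Hw. specialize (Mp w (Rlt_le _ _ (In w (Req_le _ _ Hw)))).
    rewrite !FE in Mp. rewrite <- Hw. revert Mp. rewrite !Cmod2_alt.
    destruct (f w) as [f1 f2], (f p) as [g1 g2], w as [w1 w2], p as [p1 p2], z0 as [x0 y0].
    simpl. intros. nra.
Qed.

Lemma rotate_to_Re z : exists u, Cmod u = 1 /\ Re (u * z) = Cmod z.
Proof.
  destruct (classic (z = RtoC 0)) as [->|N].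
  - exists (RtoC 1). rewrite Cmod_1, Cmod_0. split; [easy|]. simpl; ring.
  - pose proof (proj1 (Cmod_gt_0 _) N) as P.
    exists (Cconj z / RtoC (Cmod z))%C.
    assert (N' : RtoC (Cmod z) <> RtoC 0) by (intros E; apply RtoC_inj in E; lra).
    split.
    + rewrite Cmod_div, Cmod_conj, Cmod_R, Rabs_pos_eq by (auto; lra). field; lra.
    + replace (Cconj z / RtoC (Cmod z) * z)%C with (z * Cconj z / RtoC (Cmod z))%C by (now field).
      rewrite <- Cmod2_conj. replace (RtoC (Cmod z ^ 2) / RtoC (Cmod z))%C with (RtoC (Cmod z)).
      * reflexivity.
      * rewrite <- RtoC_div by lra. f_equal. field. lra.
Qed.

Theorem max_principle f z0 R M b :
  0 < R ->
  (forall z, Cmod (z - z0) <= R -> cont_at f z) ->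
  (forall z, z <> b -> Cmod (z - z0) < R -> holo f z) ->
  (forall z, Cmod (z - z0) = R -> Cmod (f z) <= M) ->
  forall z, Cmod (z - z0) <= R -> Cmod (f z) <= M.
Proof.
  intros HR Hc Hh HM z Hz. destruct (rotate_to_Re (f z)) as [u [Hu <-]].
  apply (max_principle_Re (fun w => u * f w)%C z0 R M b HR); auto.
  - intros w Hw. apply cont_at_mult; auto using cont_at_const.
  - intros w N Hw. apply holo_mult; auto using holo_const.
  - intros w Hw. eapply Rle_trans; [apply Rle_abs|]. eapply Rle_trans; [apply re_le_Cmod|].
    rewrite Cmod_mult, Hu, Rmult_1_l. now apply HM.
Qed.

Lemma min_principle f z0 R m b :
  0 < R -> 0 < m ->
  (forall z, Cmod (z - z0) <= R -> cont_at f z) ->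
  (forall z, z <> b -> Cmod (z - z0) < R -> holo f z) ->
  (forall z, Cmod (z - z0) <= R -> f z <> RtoC 0) ->
  (forall z, Cmod (z - z0) = R -> m <= Cmod (f z)) ->
  forall z, Cmod (z - z0) <= R -> m <= Cmod (f z).
Proof.
  intros HR Hm Hc Hh N HM z Hz.
  assert (X : Cmod (/ f z) <= / m).
  { apply (max_principle (fun w => / f w)%C z0 R (/ m) b HR); auto.
    - intros w Hw. apply cont_at_inv; auto.
    - intros w Nw Hw. apply holo_inv; [auto|]. apply N; lra.
    - intros w Hw. rewrite Cmod_inv by (apply N; lra). apply Rinv_le_contravar; auto. }
  rewrite Cmod_inv in X by auto.
  assert (P : 0 < Cmod (f z)) by (apply Cmod_gt_0; auto).
  rewrite <- (Rinv_inv m), <- (Rinv_inv (Cmod (f z))). apply Rinv_le_contravar; auto.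
  now apply Rinv_0_lt_compat.
Qed.

(** The contrapositive of the minimum principle. It takes the place of Rouche's theorem, both for
    the open mapping theorem and for the surjectivity of [Psi] at large height. *)
Lemma zero_in_disc f z0 R m :
  0 < R -> (forall z, Cmod (z - z0) <= R -> holo f z) ->
  (forall z, Cmod (z - z0) = R -> m <= Cmod (f z)) -> Cmod (f z0) < m ->
  exists z, Cmod (z - z0) < R /\ f z = RtoC 0.
Proof.
  intros HR Hh Hm H0. apply NNPP. intros N.
  assert (P : 0 < m) by (generalize (Cmod_ge_0 (f z0)); lra).
  assert (m <= Cmod (f z0)); [|lra].
  apply (min_principle f z0 R m z0 HR P).
  - intros; now apply holo_cont, Hh.
  - intros; apply Hh; lra.
  - intros z [Hz|Hz] E.
    + apply N. now exists z.
    + specialize (Hm z Hz). rewrite E, Cmod_0 in Hm. lra.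
  - easy.
  - rewrite Cminus_refl, Cmod_0. lra.
Qed.

(** * Schwarz-Pick inequalities *)

(** The slope of [f] at [z0] has modulus at most [/ r] on each circle of radius [r < R], hence
    inside it; then [r] tends to [R]. *)
Lemma schwarz f z0 R :
  0 < R -> (forall z, Cmod (z - z0) < R -> holo f z) ->
  (forall z, Cmod (z - z0) < R -> Cmod (f z) <= 1) -> f z0 = RtoC 0 ->
  forall z, Cmod (z - z0) < R -> R * Cmod (f z) <= Cmod (z - z0).
Proof.
  intros HR Hh H1 H0 z Hz.
  destruct (Hh z0) as [l Hl]; [now rewrite Cminus_refl, Cmod_0|].
  destruct (cderiv_slope f z0 l Hl) as [k [Ck [_ [Ek Hk]]]].
  assert (Ek' : forall w, Cmod (f w) = Cmod (k w) * Cmod (w - z0)).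
  { intros w. rewrite <- Cmod_mult, <- Ek, H0. f_equal. ring. }
  assert (B : forall r, Cmod (z - z0) < r -> r < R -> r * Cmod (f z) <= Cmod (z - z0)).
  { intros r Hr1 Hr2. assert (0 < r) by (generalize (Cmod_ge_0 (z - z0)); lra).
    assert (Q : Cmod (k z) <= / r).
    { apply (max_principle k z0 r (/ r) z0); auto; try lra.
      - intros w Hw. destruct (classic (w = z0)) as [->|N]; [easy|].
        apply holo_cont, Hk, Hh; [easy|lra].
      - intros w N Hw. apply Hk, Hh; [easy|lra].
      - intros w Hw. specialize (H1 w ltac:(lra)). rewrite Ek', Hw in H1.
        apply Rmult_le_reg_r with r; [easy|]. rewrite Rinv_l by lra. exact H1. }
    rewrite Ek'. assert (r * Cmod (k z) <= 1).
    { rewrite <- (Rinv_r r) by lra. apply Rmult_le_compat_l; lra. }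
    generalize (Cmod_ge_0 (z - z0)). nra. }
  (* The passage to the limit: a violation means that [q = d / Cmod (f z)] is below [R], and a
     radius strictly between [Rmax d q] and [R] contradicts [B]. *)
  apply Rnot_lt_le. intros L. set (d := Cmod (z - z0)) in *.
  assert (Hd : 0 <= d) by apply Cmod_ge_0.
  assert (F : 0 < Cmod (f z)) by nra.
  assert (D : d / Cmod (f z) < R).
  { apply Rmult_lt_reg_r with (Cmod (f z)); [easy|]. unfold Rdiv.
    rewrite Rmult_assoc, Rinv_l; lra. }
  set (q := d / Cmod (f z)) in *.
  assert (E : d = q * Cmod (f z)) by (unfold q; field; lra).
  set (r := (Rmax d q + R) / 2).
  assert (d <= Rmax d q) by apply Rmax_l. assert (q <= Rmax d q) by apply Rmax_r.
  assert (Rmax d q < R) by (now apply Rmax_lub_lt).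
  specialize (B r ltac:(unfold r; lra) ltac:(unfold r; lra)).
  rewrite E in B. apply Rmult_le_reg_r in B; [unfold r in B; lra|easy].
Qed.

Lemma half_plane_gap w a :
  Cmod (w - Cconj a) ^ 2 - Cmod (w - a) ^ 2 = 4 * Im w * Im a.
Proof. rewrite !Cmod2_alt. destruct w, a; simpl. ring. Qed.

Lemma disc_gap w a :
  Cmod (1 - Cconj a * w) ^ 2 - Cmod (w - a) ^ 2 = (1 - Cmod a ^ 2) * (1 - Cmod w ^ 2).
Proof. rewrite !Cmod2_alt. destruct w, a; simpl. ring. Qed.

Lemma Cmod_le_of_sqr x y : Cmod x ^ 2 <= Cmod y ^ 2 -> Cmod x <= Cmod y.
Proof.
  intros H. apply Rsqr_incr_0; rewrite ?Rsqr_pow2; auto using Cmod_ge_0.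
Qed.

Lemma Cmod_lt_of_sqr x y : Cmod x ^ 2 < Cmod y ^ 2 -> Cmod x < Cmod y.
Proof.
  intros H. apply Rsqr_incrst_0; rewrite ?Rsqr_pow2; auto using Cmod_ge_0.
Qed.

Lemma half_plane_conj_lt w a :
  0 < Im w -> 0 < Im a -> Cmod (w - a) < Cmod (w - Cconj a).
Proof.
  intros Hw Ha. apply Cmod_lt_of_sqr. generalize (half_plane_gap w a). nra.
Qed.

Lemma disc_mobius_lt w a :
  Cmod w < 1 -> Cmod a < 1 -> Cmod (w - a) < Cmod (1 - Cconj a * w).
Proof.
  intros Hw Ha. apply Cmod_lt_of_sqr. generalize (disc_gap w a).
  generalize (Cmod_ge_0 w) (Cmod_ge_0 a). intros.
  assert (0 < (1 - Cmod a ^ 2) * (1 - Cmod w ^ 2)) by (apply Rmult_lt_0_compat; nra). lra.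
Qed.

Lemma Cmod_lt_neq_0 x y : Cmod x < Cmod y -> y <> RtoC 0.
Proof. intros H. apply Cmod_gt_0. generalize (Cmod_ge_0 x). lra. Qed.

(** Schwarz's lemma after the Cayley transform sending [f z0] to the origin. The source is a
    Euclidean disc of arbitrary radius, so that large discs inside a half-plane can be used
    directly. *)
Lemma schwarz_pick_ball_half f z0 R z :
  (forall w, Cmod (w - z0) < R -> holo f w) ->
  (forall w, Cmod (w - z0) < R -> 0 < Im (f w)) -> Cmod (z - z0) < R ->
  R * Cmod (f z - f z0) <= Cmod (z - z0) * Cmod (f z - Cconj (f z0)).
Proof.
  intros Hh Hi Hz. assert (HR : 0 < R) by (generalize (Cmod_ge_0 (z - z0)); lra).
  set (a := f z0). assert (Ha : 0 < Im a) by (apply Hi; now rewrite Cminus_refl, Cmod_0).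
  assert (N : forall w, Cmod (w - z0) < R -> (f w - Cconj a)%C <> RtoC 0).
  { intros w Hw. eapply Cmod_lt_neq_0, half_plane_conj_lt; auto. }
  assert (S := schwarz (fun w => (f w - a) / (f w - Cconj a))%C z0 R HR).
  cbv beta in S. specialize (fun A B C => S A B C z Hz).
  rewrite Cmod_div in S by auto.
  assert (P := proj1 (Cmod_gt_0 _) (N z Hz)).
  apply Rmult_le_reg_r with (/ Cmod (f z - Cconj a)); [now apply Rinv_0_lt_compat|].
  rewrite (Rmult_assoc (Cmod (z - z0))), Rinv_r, Rmult_1_r, Rmult_assoc by lra.
  apply S.
  - intros w Hw. apply holo_div; auto; apply holo_minus; auto using holo_const.
  - intros w Hw. rewrite Cmod_div by auto.
    apply Rle_div_l; [apply Cmod_gt_0; auto|]. rewrite Rmult_1_l. left.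
    apply half_plane_conj_lt; auto.
  - unfold a. rewrite Cminus_refl. unfold Cdiv. ring.
Qed.

Lemma schwarz_pick_ball_disc f z0 R z :
  (forall w, Cmod (w - z0) < R -> holo f w) ->
  (forall w, Cmod (w - z0) < R -> Cmod (f w) < 1) -> Cmod (z - z0) < R ->
  R * Cmod (f z - f z0) <= Cmod (z - z0) * Cmod (1 - Cconj (f z0) * f z).
Proof.
  intros Hh Hi Hz. assert (HR : 0 < R) by (generalize (Cmod_ge_0 (z - z0)); lra).
  set (a := f z0). assert (Ha : Cmod a < 1) by (apply Hi; now rewrite Cminus_refl, Cmod_0).
  assert (N : forall w, Cmod (w - z0) < R -> (1 - Cconj a * f w)%C <> RtoC 0).
  { intros w Hw. eapply Cmod_lt_neq_0, disc_mobius_lt; auto. }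
  assert (S := schwarz (fun w => (f w - a) / (1 - Cconj a * f w))%C z0 R HR).
  cbv beta in S. specialize (fun A B C => S A B C z Hz).
  rewrite Cmod_div in S by auto.
  assert (P := proj1 (Cmod_gt_0 _) (N z Hz)).
  apply Rmult_le_reg_r with (/ Cmod (1 - Cconj a * f z)); [now apply Rinv_0_lt_compat|].
  rewrite (Rmult_assoc (Cmod (z - z0))), Rinv_r, Rmult_1_r, Rmult_assoc by lra.
  apply S.
  - intros w Hw. apply holo_div; auto; apply holo_minus; auto using holo_const.
    apply holo_mult; auto using holo_const.
  - intros w Hw. rewrite Cmod_div by auto.
    apply Rle_div_l; [apply Cmod_gt_0; auto|]. rewrite Rmult_1_l. left.
    apply disc_mobius_lt; auto.
  - unfold a. rewrite Cminus_refl. unfold Cdiv. ring.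
Qed.

(** A Moebius parametrization centred at [a], in which the preimage [x] of [z] has as modulus the
    pseudo-hyperbolic distance from [a] to [z]. It reduces Schwarz-Pick at an arbitrary base point
    to the case of a disc about the origin. *)
Lemma disc_chart a z :
  Cmod a < 1 -> Cmod z < 1 ->
  exists (m : C -> C) (x : C), Cmod x < 1 /\ m (RtoC 0) = a /\ m x = z /\
    Cmod x * Cmod (1 - Cconj a * z) = Cmod (z - a) /\
    forall w, Cmod w < 1 -> holo m w /\ Cmod (m w) < 1.
Proof.
  intros Ha Hz.
  assert (L := disc_mobius_lt z a Hz Ha). assert (N := Cmod_lt_neq_0 _ _ L).
  assert (L0 := disc_mobius_lt a a Ha Ha). assert (N0 := Cmod_lt_neq_0 _ _ L0).
  exists (fun w => (w + a) / (1 + Cconj a * w))%C, ((z - a) / (1 - Cconj a * z))%C.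
  assert (P := proj1 (Cmod_gt_0 _) N).
  repeat split.
  - rewrite Cmod_div by easy. apply Rlt_div_l; [easy|]. lra.
  - field.
  - assert (E : (1 + Cconj a * ((z - a) / (1 - Cconj a * z)))%C =
                ((1 - Cconj a * a) / (1 - Cconj a * z))%C) by (field; easy).
    rewrite E. field. split; easy.
  - rewrite Cmod_div by easy. field. lra.
  - assert (Nw : (1 + Cconj a * w)%C <> RtoC 0).
    { replace (1 + Cconj a * w)%C with (1 - Cconj (- a) * w)%C
        by (rewrite Copp_conj; ring).
      eapply Cmod_lt_neq_0, disc_mobius_lt; [easy|now rewrite Cmod_opp]. }
    apply holo_div; [| |easy]; apply holo_plus; auto using holo_const, holo_id.
    apply holo_mult; auto using holo_const, holo_id.
  - assert (Lw : Cmod (w + a) < Cmod (1 + Cconj a * w)).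
    { replace (1 + Cconj a * w)%C with (1 - Cconj (- a) * w)%C
        by (rewrite Copp_conj; ring).
      replace (w + a)%C with (w - - a)%C by ring.
      apply disc_mobius_lt; [easy|now rewrite Cmod_opp]. }
    assert (Nw := Cmod_lt_neq_0 _ _ Lw).
    rewrite Cmod_div by easy. apply Rlt_div_l; [now apply Cmod_gt_0|]. lra.
Qed.

Lemma Im_div u v : v <> RtoC 0 -> Im (u / v) * Cmod v ^ 2 = Im (u * Cconj v).
Proof.
  intros N. apply Cmod_gt_0 in N. rewrite Cmod2_alt.
  assert (P : 0 < Cmod v ^ 2) by (now apply pow_lt). rewrite Cmod2_alt in P.
  destruct u as [a b], v as [c d]. simpl in *. field. lra.
Qed.

Lemma half_plane_chart a z :
  0 < Im a -> 0 < Im z ->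
  exists (m : C -> C) (x : C), Cmod x < 1 /\ m (RtoC 0) = a /\ m x = z /\
    Cmod x * Cmod (z - Cconj a) = Cmod (z - a) /\
    forall w, Cmod w < 1 -> holo m w /\ 0 < Im (m w).
Proof.
  intros Ha Hz.
  assert (L := half_plane_conj_lt z a Hz Ha). assert (N := Cmod_lt_neq_0 _ _ L).
  assert (L0 := half_plane_conj_lt a a Ha Ha). assert (N0 := Cmod_lt_neq_0 _ _ L0).
  assert (P := proj1 (Cmod_gt_0 _) N).
  exists (fun w => (a - Cconj a * w) / (1 - w))%C, ((z - a) / (z - Cconj a))%C.
  repeat split.
  - rewrite Cmod_div by easy. apply Rlt_div_l; [easy|]. lra.
  - field.
  - assert (E : (1 - (z - a) / (z - Cconj a))%C = ((a - Cconj a) / (z - Cconj a))%C)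
      by (field; easy).
    rewrite E. field. split; easy.
  - rewrite Cmod_div by easy. field. lra.
  - assert (Nw : (1 - w)%C <> RtoC 0).
    { intros E. apply Cminus_eq_0 in E. rewrite <- E, Cmod_1 in H. lra. }
    apply holo_div; [| |easy]; apply holo_minus; auto using holo_const, holo_id.
    apply holo_mult; auto using holo_const, holo_id.
  - assert (Nw : (1 - w)%C <> RtoC 0).
    { intros E. apply Cminus_eq_0 in E. rewrite <- E, Cmod_1 in H. lra. }
    assert (E := Im_div (a - Cconj a * w) (1 - w) Nw).
    assert (E2 : Im ((a - Cconj a * w) * Cconj (1 - w)) = Im a * (1 - Cmod w ^ 2)).
    { rewrite Cmod2_alt. destruct a, w; simpl. ring. }
    rewrite E2 in E. apply Cmod_gt_0 in Nw.
    assert (0 < Cmod (1 - w) ^ 2) by (now apply pow_lt).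
    assert (0 < Im a * (1 - Cmod w ^ 2)).
    { apply Rmult_lt_0_compat; [easy|]. generalize (Cmod_ge_0 w). nra. }
    nra.
Qed.

Lemma schwarz_pick_disc_half f z a :
  (forall w, Cmod w < 1 -> holo f w) -> (forall w, Cmod w < 1 -> 0 < Im (f w)) ->
  Cmod a < 1 -> Cmod z < 1 ->
  Cmod (f z - f a) * Cmod (1 - Cconj a * z) <= Cmod (z - a) * Cmod (f z - Cconj (f a)).
Proof.
  intros Hh Hi Ha Hz.
  destruct (disc_chart a z Ha Hz) as [m [x [Hx [E0 [Ex [D Hm]]]]]].
  assert (Z : forall w, (w - RtoC 0)%C = w) by (intros; ring).
  assert (S := schwarz_pick_ball_half (fun w => f (m w)) (RtoC 0) 1 x).
  rewrite Z, E0, Ex, Rmult_1_l in S. rewrite <- D.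
  rewrite Rmult_comm, (Rmult_comm (Cmod x)), Rmult_assoc.
  apply Rmult_le_compat_l; [apply Cmod_ge_0|]. apply S; [| |easy];
    intros w; rewrite Z; intros Hw; destruct (Hm w Hw); auto.
  apply holo_comp; auto.
Qed.

Lemma schwarz_pick_disc_disc f z a :
  (forall w, Cmod w < 1 -> holo f w) -> (forall w, Cmod w < 1 -> Cmod (f w) < 1) ->
  Cmod a < 1 -> Cmod z < 1 ->
  Cmod (f z - f a) * Cmod (1 - Cconj a * z) <= Cmod (z - a) * Cmod (1 - Cconj (f a) * f z).
Proof.
  intros Hh Hi Ha Hz.
  destruct (disc_chart a z Ha Hz) as [m [x [Hx [E0 [Ex [D Hm]]]]]].
  assert (Z : forall w, (w - RtoC 0)%C = w) by (intros; ring).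
  assert (S := schwarz_pick_ball_disc (fun w => f (m w)) (RtoC 0) 1 x).
  rewrite Z, E0, Ex, Rmult_1_l in S. rewrite <- D.
  rewrite Rmult_comm, (Rmult_comm (Cmod x)), Rmult_assoc.
  apply Rmult_le_compat_l; [apply Cmod_ge_0|]. apply S; [| |easy];
    intros w; rewrite Z; intros Hw; destruct (Hm w Hw); auto.
  apply holo_comp; auto.
Qed.

Lemma schwarz_pick_half_half f z a :
  (forall w, 0 < Im w -> holo f w) -> (forall w, 0 < Im w -> 0 < Im (f w)) ->
  0 < Im a -> 0 < Im z ->
  Cmod (f z - f a) * Cmod (z - Cconj a) <= Cmod (z - a) * Cmod (f z - Cconj (f a)).
Proof.
  intros Hh Hi Ha Hz.
  destruct (half_plane_chart a z Ha Hz) as [m [x [Hx [E0 [Ex [D Hm]]]]]].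
  assert (Z : forall w, (w - RtoC 0)%C = w) by (intros; ring).
  assert (S := schwarz_pick_ball_half (fun w => f (m w)) (RtoC 0) 1 x).
  rewrite Z, E0, Ex, Rmult_1_l in S. rewrite <- D.
  rewrite Rmult_comm, (Rmult_comm (Cmod x)), Rmult_assoc.
  apply Rmult_le_compat_l; [apply Cmod_ge_0|]. apply S; [| |easy];
    intros w; rewrite Z; intros Hw; destruct (Hm w Hw); auto.
  apply holo_comp; auto.
Qed.

(* [G / w ^ n] stays bounded, so [G] is smaller than every power of [|w|]. *)
Lemma identity_disc_origin G B r :
  0 < r -> (forall w, Cmod w < 1 -> holo G w) -> (forall w, Cmod w < 1 -> Cmod (G w) <= B) ->
  (forall w, Cmod w < r -> G w = RtoC 0) -> forall w, Cmod w < 1 -> G w = RtoC 0.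
Proof.
  intros Hr Hh HB H0 w Hw.
  assert (Z : forall w, (w - RtoC 0)%C = w) by (intros; ring).
  destruct (classic (w = RtoC 0)) as [->|Nw]; [apply H0; now rewrite Cmod_0|].
  assert (Pw := proj1 (Cmod_gt_0 _) Nw).
  assert (HB0 : 0 <= B) by (eapply Rle_trans; [apply Cmod_ge_0|apply (HB w Hw)]).
  set (s := (1 + Cmod w) / 2).
  assert (Hpow : forall n v, v <> RtoC 0 -> (v ^ n)%C <> RtoC 0).
  { intros n v Nv. apply Cmod_gt_0. rewrite Cmod_pow. apply pow_lt. now apply Cmod_gt_0. }
  assert (Hhol : forall n v, holo (fun v => v ^ n)%C v).
  { induction n as [|n IH]; intros v; simpl; [apply holo_const|].
    apply holo_mult; [apply holo_id|apply IH]. }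
  assert (Q : forall n, Cmod (G w) <= B * (Cmod w / s) ^ n).
  { intros n.
    assert (X : Cmod (G w / w ^ n) <= B / s ^ n).
    { assert (HF : forall v, Cmod v < 1 -> holo (fun v => G v / v ^ n)%C v).
      { intros v Hv. destruct (classic (v = RtoC 0)) as [->|N].
        - apply (holo_ext_loc (fun _ => RtoC 0) _ _ r Hr); [|apply holo_const].
          intros v Hv'. rewrite Z in Hv'. rewrite H0 by easy. unfold Cdiv. ring.
        - apply holo_div; auto. }
      apply (max_principle (fun v => G v / v ^ n)%C (RtoC 0) s _ (RtoC 0));
        unfold s; try (intros v); rewrite ?Z; try lra.
      - intros Hv. apply holo_cont, HF. lra.
      - intros _ Hv. apply HF. lra.
      - intros Hv. assert (Nv : v <> RtoC 0) by (apply Cmod_gt_0; lra).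
        rewrite Cmod_div, Cmod_pow, Hv by auto.
        apply Rmult_le_compat_r; [|apply HB; lra].
        left. apply Rinv_0_lt_compat, pow_lt. lra. }
    rewrite Cmod_div, Cmod_pow in X by auto.
    assert (0 < Cmod w ^ n) by (now apply pow_lt).
    assert (0 < s ^ n) by (apply pow_lt; unfold s; lra).
    apply Rmult_le_reg_r with (/ Cmod w ^ n); [now apply Rinv_0_lt_compat|].
    eapply Rle_trans; [exact X|]. right. unfold Rdiv.
    rewrite Rpow_mult_distr, pow_inv. field. split; lra. }
  apply Cmod_eq_0, Rle_antisym; [|apply Cmod_ge_0]. apply Rnot_lt_le. intros L.
  assert (Hq : 0 <= Cmod w / s < 1).
  { assert (0 < s) by (unfold s; lra). split.
    - apply Rmult_le_pos; [lra|]. left; now apply Rinv_0_lt_compat.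
    - apply Rlt_div_l; [easy|]. unfold s; lra. }
  destruct (pow_lt_1_zero (Cmod w / s)) with (y := Cmod (G w) / (B + 1)) as [N HN].
  - rewrite Rabs_pos_eq; lra.
  - apply Rdiv_lt_0_compat; lra.
  - specialize (HN N (Nat.le_refl _)). specialize (Q N).
    assert (Pq := pow_le _ N (proj1 Hq)). rewrite Rabs_pos_eq in HN by easy.
    apply Rlt_div_r in HN; [|lra]. nra.
Qed.

(** A chart moves [a] to the origin, where the difference of two self-maps is bounded by 2 and
    vanishes on a small disc. *)
Lemma identity_disc f g a r :
  (forall w, Cmod w < 1 -> holo f w) -> (forall w, Cmod w < 1 -> Cmod (f w) < 1) ->
  (forall w, Cmod w < 1 -> holo g w) -> (forall w, Cmod w < 1 -> Cmod (g w) < 1) ->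
  0 < r -> Cmod a < 1 -> (forall w, Cmod (w - a) < r -> f w = g w) ->
  forall z, Cmod z < 1 -> f z = g z.
Proof.
  intros Hf Bf Hg Bg Hr Ha E z Hz.
  destruct (disc_chart a z Ha Hz) as [m [x [Hx [E0 [Ex [_ Hm]]]]]].
  assert (Z : forall w, (w - RtoC 0)%C = w) by (intros; ring).
  assert (C0 : cont_at m (RtoC 0)) by (apply holo_cont, Hm; rewrite Cmod_0; lra).
  destruct (C0 r Hr) as [d [Hd Hd']].
  rewrite <- Ex. apply Cminus_eq_0.
  apply (identity_disc_origin (fun w => f (m w) - g (m w))%C 2 d Hd); auto.
  - intros w Hw. destruct (Hm w Hw). apply holo_minus; apply holo_comp; auto.
  - intros w Hw. destruct (Hm w Hw) as [_ Bw]. eapply Rle_trans; [apply Cmod_triangle|].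
    rewrite Cmod_opp. specialize (Bf _ Bw). specialize (Bg _ Bw). lra.
  - intros w Hw. rewrite E; [ring|]. rewrite <- E0. apply Hd'. now rewrite Z.
Qed.

(** * Inverses of injective holomorphic maps *)

Lemma circle_min F z0 R :
  0 <= R -> (forall z, Cmod (z - z0) = R -> cont_at F z /\ F z <> RtoC 0) ->
  exists m, 0 < m /\ forall z, Cmod (z - z0) = R -> m <= Cmod (F z).
Proof.
  intros HR H.
  assert (E : forall z, Re (RtoC (-1) * (F z * Cconj (F z))) = - Cmod (F z) ^ 2).
  { intros z. rewrite <- Cmod_sqr_re. destruct (F z * Cconj (F z))%C. simpl. ring. }
  destruct (circle_max (fun z => RtoC (-1) * (F z * Cconj (F z)))%C z0 R) as [p [Hp Mp]]; auto.
  - intros z Hz. apply cont_at_mult; [apply cont_at_const|].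
    apply cont_at_mult; [now apply H|].
    apply (cont_at_comp Cconj F); [now apply H|apply cont_at_conj].
  - exists (Cmod (F p)). split; [apply Cmod_gt_0; now apply H|]. intros z Hz.
    specialize (Mp z Hz). rewrite !E in Mp. apply Cmod_le_of_sqr. lra.
Qed.

Lemma open_mapping h z0 r :
  0 < r -> (forall z, Cmod (z - z0) <= r -> holo h z) ->
  (forall z, Cmod (z - z0) = r -> h z <> h z0) ->
  exists d, 0 < d /\ forall v, Cmod (v - h z0) < d -> exists z, Cmod (z - z0) < r /\ h z = v.
Proof.
  intros Hr Hh N.
  assert (Hs : forall v z, Cmod (z - z0) <= r -> holo (fun w => h w - v)%C z)
    by (intros; apply holo_minus; auto using holo_const).
  destruct (circle_min (fun z => h z - h z0)%C z0 r) as [m [Hm Hm']]; [lra| |].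
  { intros z Hz. split; [apply holo_cont, Hs; lra|].
    intros E. apply (N z Hz). now apply Cminus_eq_0. }
  exists (m / 2); split; [lra|]. intros v Hv.
  destruct (zero_in_disc (fun w => h w - v)%C z0 r (m / 2)) as [z [Hz E]]; auto.
  - intros z Hz. specialize (Hm' z Hz). generalize (Cmod_triangle_sub (h z) v (h z0)). lra.
  - now rewrite Cmod_sub_sym.
  - exists z; split; [easy|]. now apply Cminus_eq_0.
Qed.

Lemma Re_minus z w : Re (z - w)%C = Re z - Re w.
Proof. reflexivity. Qed.

(** A rotation makes the increment of [h] real and nonnegative, which reduces the claim to the real
    mean value theorem. *)
Lemma constant_on_segment h z0 d :
  (forall t, 0 <= t <= 1 -> cderiv h (z0 + RtoC t * d)%C (RtoC 0)) -> h (z0 + d)%C = h z0.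
Proof.
  intros H. destruct (rotate_to_Re (h (z0 + d)%C - h z0)%C) as [u [Hu E]].
  pose (g := fun t => Re (u * (h (z0 + RtoC t * d)%C))).
  assert (D : forall t, 0 <= t <= 1 -> derivable_pt_lim g t 0).
  { intros t Ht eps He.
    assert (HD : 0 < Cmod d + 1) by (generalize (Cmod_ge_0 d); lra).
    destruct (cderiv_elim _ _ _ (H t Ht) (eps / 2 / (Cmod d + 1))) as [e [He' Hd]].
    { apply Rdiv_lt_0_compat; lra. }
    assert (P : 0 < e / (Cmod d + 1)) by (now apply Rdiv_lt_0_compat).
    exists (mkposreal _ P). intros k Hk Lk. simpl in Lk. unfold g.
    assert (Q : (z0 + RtoC (t + k) * d - (z0 + RtoC t * d))%C = (RtoC k * d)%C)
      by (rewrite RtoC_plus; ring).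
    specialize (Hd (z0 + RtoC (t + k) * d)%C). rewrite Q, Cmod_mult, Cmod_R in Hd.
    replace (h (z0 + RtoC (t + k) * d)%C - h (z0 + RtoC t * d)%C - 0 * (RtoC k * d))%C
      with (h (z0 + RtoC (t + k) * d)%C - h (z0 + RtoC t * d)%C)%C in Hd by ring.
    assert (Pk := Rabs_pos_lt _ Hk).
    rewrite Rminus_0_r, <- Re_minus. unfold Rdiv at 1. rewrite Rabs_mult, Rabs_inv.
    apply Rlt_div_l; [easy|].
    replace (u * h (z0 + RtoC (t + k) * d)%C - u * h (z0 + RtoC t * d)%C)%C
      with (u * (h (z0 + RtoC (t + k) * d)%C - h (z0 + RtoC t * d)%C))%C by ring.
    eapply Rle_lt_trans; [apply re_le_Cmod|]. rewrite Cmod_mult, Hu, Rmult_1_l.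
    assert (Lk' : Rabs k * (Cmod d + 1) < e) by (now apply Rlt_div_r in Lk).
    eapply Rle_lt_trans; [apply Hd|].
    - generalize (Cmod_ge_0 d). nra.
    - apply Rle_lt_trans with (eps / 2 / (Cmod d + 1) * (Rabs k * (Cmod d + 1))).
      + apply Rmult_le_compat_l; [left; apply Rdiv_lt_0_compat; lra|]. nra.
      + replace (eps / 2 / (Cmod d + 1) * (Rabs k * (Cmod d + 1))) with (eps / 2 * Rabs k)
          by (field; lra). nra. }
  destruct (MVT_gen g 0 1 (fun _ => 0)) as [t [_ Et]].
  - rewrite Rmin_left, Rmax_right by lra. intros t Ht. apply is_derive_Reals, D. lra.
  - rewrite Rmin_left, Rmax_right by lra. intros t Ht. apply derivable_continuous_pt.
    exists 0. now apply D.
  - apply Cmod_eq. rewrite <- E.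
    replace (u * (h (z0 + d)%C - h z0))%C with (u * h (z0 + d)%C - u * h z0)%C by ring.
    rewrite Re_minus. unfold g in Et.
    replace (z0 + RtoC 1 * d)%C with (z0 + d)%C in Et by ring.
    replace (z0 + RtoC 0 * d)%C with z0 in Et by ring. lra.
Qed.

(* Hurwitz-type argument: the slopes [w => (h w - h b) / (w - b)] have no zero,
   and are bounded below near the circle uniformly in [b] close to [z0]. *)
Lemma injective_cderiv_neq_0 h z0 r l :
  0 < r -> (forall z, Cmod (z - z0) <= r -> holo h z) ->
  (forall z w, Cmod (z - z0) <= r -> Cmod (w - z0) <= r -> h z = h w -> z = w) ->
  cderiv h z0 l -> l <> RtoC 0.
Proof.
  intros Hr Hh Inj Hl El. subst l.
  assert (Zc : Cmod (z0 - z0) <= r) by (rewrite Cminus_refl, Cmod_0; lra).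
  destruct (circle_min (fun z => h z - h z0)%C z0 r) as [m [Hm Hm']]; [lra| |].
  { intros z Hz. split.
    - apply holo_cont, holo_minus; auto using holo_const. apply Hh; lra.
    - intros E. apply Cminus_eq_0, Inj in E; try lra. subst z.
      rewrite Cminus_refl, Cmod_0 in Hz. lra. }
  destruct (cderiv_elim _ _ _ Hl (m / (8 * r))) as [d1 [Hd1 H1]].
  { apply Rdiv_lt_0_compat; lra. }
  destruct (holo_cont _ _ (Hh z0 Zc) (m / 2)) as [d2 [Hd2 H2]]; [lra|].
  set (d := Rmin (Rmin d1 d2) r).
  assert (Hd : 0 < d) by (repeat apply Rmin_pos; lra).
  assert (D1 : d <= d1) by (eapply Rle_trans; apply Rmin_l).
  assert (D2 : d <= d2) by (eapply Rle_trans; [apply Rmin_l|apply Rmin_r]).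
  assert (D3 : d <= r) by apply Rmin_r.
  (* A zero derivative at [z0] would spread to all nearby [b], making [h] constant on a segment.
     Indeed, if the derivative at [b] were nonzero, the slope [k0] based at [b] would have no zero
     and the minimum principle would give [m / (4 * r) <= Cmod (k0 z0)], whereas flatness at [z0]
     gives at most [m / (8 * r)]. *)
  assert (Flat : forall b, Cmod (b - z0) < d -> cderiv h b (RtoC 0)).
  { intros b Hb. destruct (classic (b = z0)) as [->|Nb]; [easy|].
    destruct (Hh b ltac:(lra)) as [l Hlb]. destruct (classic (l = RtoC 0)) as [->|Nl]; [easy|].
    exfalso. destruct (cderiv_slope h b l Hlb) as [k0 [Ck0 [Ek0 [Sk0 Hk0]]]].
    assert (Low : m / (4 * r) <= Cmod (k0 z0)).
    { apply (min_principle k0 z0 r (m / (4 * r)) b Hr); auto.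
      - apply Rdiv_lt_0_compat; lra.
      - intros w Hw. destruct (classic (w = b)) as [->|N]; [easy|].
        now apply holo_cont, Hk0, Hh.
      - intros w N Hw. apply Hk0, Hh; [easy|lra].
      - intros w Hw E. destruct (classic (w = b)) as [->|N]; [now rewrite Ek0 in E|].
        apply N, Inj; [easy|lra|]. apply Cminus_eq_0. rewrite Sk0, E. ring.
      - intros w Hw.
        assert (A : m / 2 <= Cmod (h w - h b)).
        { specialize (Hm' w Hw). specialize (H2 b ltac:(lra)).
          generalize (Cmod_triangle_sub (h w) (h b) (h z0)). lra. }
        rewrite Sk0, Cmod_mult in A.
        assert (B : Cmod (w - b) <= 2 * r).
        { generalize (Cmod_triangle_sub w z0 b). rewrite (Cmod_sub_sym z0 b). lra. }
        apply Rmult_le_reg_r with (2 * r); [lra|].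
        replace (m / (4 * r) * (2 * r)) with (m / 2) by (field; lra).
        eapply Rle_trans; [exact A|]. apply Rmult_le_compat_l; [apply Cmod_ge_0|easy]. }
    specialize (H1 b ltac:(lra)).
    replace (h b - h z0 - 0 * (b - z0))%C with (- (h z0 - h b))%C in H1 by ring.
    rewrite Cmod_opp, Sk0, Cmod_mult, (Cmod_sub_sym z0 b) in H1.
    assert (P : 0 < Cmod (b - z0)) by (apply Cmod_gt_0; contradict Nb; now apply Cminus_eq_0).
    apply Rmult_le_reg_r in H1; [|easy].
    assert (m / (4 * r) = 2 * (m / (8 * r))) by (field; lra).
    assert (0 < m / (8 * r)) by (apply Rdiv_lt_0_compat; lra). lra. }
  assert (E : h (z0 + RtoC (d / 2))%C = h z0).
  { apply constant_on_segment. intros t Ht. apply Flat.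
    replace (z0 + RtoC t * RtoC (d / 2) - z0)%C with (RtoC t * RtoC (d / 2))%C by ring.
    rewrite <- RtoC_mult, Cmod_R, Rabs_pos_eq; nra. }
  assert (M : Cmod (z0 + RtoC (d / 2) - z0) = d / 2).
  { replace (z0 + RtoC (d / 2) - z0)%C with (RtoC (d / 2)) by ring.
    rewrite Cmod_R, Rabs_pos_eq; lra. }
  apply Inj in E; [|lra|easy]. rewrite E, Cminus_refl, Cmod_0 in M. lra.
Qed.

(** The open mapping theorem on small circles makes [g] continuous at [h z]. If [k] is the slope of
    [h] at [z], then [/ k (g v)] is the slope of [g], and it is continuous because the derivative of
    an injective map does not vanish. *)
Lemma injective_inverse (V : C -> Prop) h g z :
  (forall w, V w -> exists r, 0 < r /\ forall v, Cmod (v - w) < r -> V v) ->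
  (forall w, V w -> holo h w) ->
  (forall w v, V w -> V v -> h w = h v -> w = v) ->
  (forall w, V w -> g (h w) = w) -> V z ->
  holo g (h z) /\
  exists d, 0 < d /\ forall v, Cmod (v - h z) < d -> exists w, V w /\ h w = v.
Proof.
  intros Op Hh Inj Hg Vz. destruct (Op z Vz) as [r [Hr HV]].
  assert (Loc : forall s, 0 < s -> s < r -> exists d, 0 < d /\
    forall v, Cmod (v - h z) < d -> exists w, V w /\ h w = v /\ Cmod (w - z) < s).
  { intros s Hs Hsr. destruct (open_mapping h z s Hs) as [d [Hd Hd']].
    - intros w Hw. apply Hh, HV. lra.
    - intros w Hw E. apply Inj in E; [|apply HV; lra|easy]. subst w.
      rewrite Cminus_refl, Cmod_0 in Hw. lra.
    - exists d; split; [easy|]. intros v Hv. destruct (Hd' v Hv) as [w [Hw E]].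
      exists w. repeat split; auto. apply HV. lra. }
  destruct (Loc (r / 2)) as [d [Hd Hd']]; [lra|lra|].
  split; [|exists d; split; [easy|]; intros v Hv; destruct (Hd' v Hv) as [w [? [? _]]]; now exists w].
  assert (Cg : cont_at g (h z)).
  { intros eps He. destruct (Loc (Rmin eps (r / 2))) as [e [He' Q]].
    - apply Rmin_pos; lra.
    - generalize (Rmin_r eps (r / 2)). lra.
    - exists e; split; [easy|]. intros v Hv. destruct (Q v Hv) as [w [Vw [<- Lw]]].
      rewrite !Hg by easy. generalize (Rmin_l eps (r / 2)). lra. }
  destruct (Hh z Vz) as [l Hl].
  assert (Nl : l <> RtoC 0).
  { apply (injective_cderiv_neq_0 h z (r / 2) l); auto; try lra.
    - intros w Hw. apply Hh, HV. lra.
    - intros w v Hw Hv. apply Inj; apply HV; lra. }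
  destruct Hl as [k [Ck [Ek Sk]]].
  assert (Ckg : cont_at (fun v => k (g v)) (h z)).
  { apply cont_at_comp; [easy|]. now rewrite Hg. }
  assert (Nk : k (g (h z)) <> RtoC 0) by (now rewrite Hg, Ek).
  destruct (cont_at_neq_0 _ _ Ckg Nk) as [e [He Qe]].
  apply (holo_ext_loc (fun v => g (h z) + / k (g v) * (v - h z))%C g (h z) (Rmin d e)).
  - now apply Rmin_pos.
  - intros v Hv.
    assert (Hv1 := Rlt_le_trans _ _ _ Hv (Rmin_l d e)).
    assert (Hv2 := Rlt_le_trans _ _ _ Hv (Rmin_r d e)).
    specialize (Qe v Hv2). destruct (Hd' v Hv1) as [w [Vw [<- _]]].
    assert (Nw : k (g (h w)) <> RtoC 0).
    { apply Cmod_gt_0. generalize (Cmod_ge_0 (k (g (h z)))). lra. }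
    rewrite Sk. rewrite !Hg in * by easy. now field.
  - eexists. exists (fun v => / k (g v))%C. repeat split.
    + now apply cont_at_inv.
    + intros v. ring.
Qed.

(** * Periodic functions on the upper half-plane *)

Lemma Cmod_sub_conj_le (z a : C) :
  0 <= Im a -> Cmod (z - Cconj a) <= Cmod (z - a) + 2 * Im a.
Proof.
  intros Ha. eapply Rle_trans; [apply (Cmod_triangle_sub z a (Cconj a))|].
  apply Rplus_le_compat_l. eapply Rle_trans; [apply Cmod_le_Re_Im|].
  destruct a as [x y]; simpl in *. replace (x + - x) with 0 by ring.
  rewrite Rabs_R0, Rabs_pos_eq; lra.
Qed.

Lemma Cmod_shift_conj a t :
  Cmod (a + RtoC t - Cconj a) ^ 2 = t ^ 2 + 4 * Im a ^ 2.
Proof. rewrite Cmod2_alt. destruct a; simpl. ring. Qed.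

(** Adding [i e] makes the imaginary part positive at the cost of an error [2 * e * Cmod (z - a)],
    which is removed by letting [e] tend to 0. The closed case matters for [Psi w - w], whose
    imaginary part may vanish. *)
Lemma schwarz_pick_half_closed f z a :
  (forall w, 0 < Im w -> holo f w) -> (forall w, 0 < Im w -> 0 <= Im (f w)) ->
  0 < Im a -> 0 < Im z ->
  Cmod (f z - f a) * Cmod (z - Cconj a) <= Cmod (z - a) * Cmod (f z - Cconj (f a)).
Proof.
  intros Hh Hi Ha Hz. apply Rnot_lt_le. intros L.
  set (X := Cmod (f z - f a) * Cmod (z - Cconj a)) in *.
  set (D := Cmod (z - a)) in *. set (Q := Cmod (f z - Cconj (f a))) in *.
  assert (HD : 0 <= D) by apply Cmod_ge_0.
  set (e := (X - D * Q) / (4 * (D + 1))).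
  assert (He : 0 < e) by (apply Rdiv_lt_0_compat; lra).
  assert (Ee : e * (4 * (D + 1)) = X - D * Q) by (unfold e; field; lra).
  assert (S := schwarz_pick_half_half (fun w => f w + Ci * RtoC e)%C z a).
  cbv beta in S.
  replace (f z + Ci * RtoC e - (f a + Ci * RtoC e))%C with (f z - f a)%C in S by ring.
  fold X D in S.
  assert (B : Cmod (f z + Ci * RtoC e - Cconj (f a + Ci * RtoC e)) <= Q + 2 * e).
  { replace (f z + Ci * RtoC e - Cconj (f a + Ci * RtoC e))%C
      with ((f z - Cconj (f a)) + (RtoC (2 * e)) * Ci)%C.
    - eapply Rle_trans; [apply Cmod_triangle|]. apply Rplus_le_compat_l.
      rewrite Cmod_mult, Cmod_Ci, Cmod_R, Rabs_pos_eq; lra.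
    - destruct (f z), (f a). unfold Cconj, Cminus, Cplus, Copp, Cmult, Ci, RtoC; simpl.
      f_equal; ring. }
  assert (X <= D * (Q + 2 * e)).
  { eapply Rle_trans; [apply S; auto|].
    - intros w Hw. apply holo_plus; auto using holo_const.
    - intros w Hw. specialize (Hi w Hw). destruct (f w). simpl in *. lra.
    - apply Rmult_le_compat_l; auto. }
  nra.
Qed.

Lemma Im_plus_R w t : Im (w + RtoC t)%C = Im w.
Proof. destruct w; simpl; ring. Qed.

Lemma Re_plus_R w t : Re (w + RtoC t)%C = Re w + t.
Proof. destruct w; simpl; ring. Qed.

Lemma reduce_period {A} (f : C -> A) :
  (forall w, 0 < Im w -> f (w + 1)%C = f w) ->
  forall w, 0 < Im w -> exists w', Im w' = Im w /\ 0 <= Re w' <= 1 /\ f w' = f w.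
Proof.
  intros H w Hw. destruct (Rle_dec 0 (Re w)) as [P|P].
  - destruct (INR_unbounded (Re w)) as [n Hn].
    assert (Q : forall n w, 0 < Im w -> 0 <= Re w <= INR n + 1 ->
              exists w', Im w' = Im w /\ 0 <= Re w' <= 1 /\ f w' = f w).
    { clear w Hw P n Hn. induction n as [|n IH]; intros w Hw Hr.
      - exists w. simpl in Hr. repeat split; auto; lra.
      - rewrite S_INR in Hr. destruct (Rle_dec (Re w) 1) as [L|L].
        + exists w. repeat split; auto; lra.
        + destruct (IH (w + RtoC (-1))%C) as [w' [A1 [A2 A3]]].
          * now rewrite Im_plus_R.
          * rewrite Re_plus_R. lra.
          * exists w'. rewrite Im_plus_R in A1. repeat split; try easy.
            rewrite A3, <- H by (now rewrite Im_plus_R). f_equal.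
            replace (RtoC (-1)) with (- RtoC 1)%C by (rewrite <- RtoC_opp; easy). ring. }
    apply (Q n); auto. lra.
  - destruct (INR_unbounded (- Re w)) as [n Hn].
    assert (Q : forall n w, 0 < Im w -> - INR n <= Re w <= 1 ->
              exists w', Im w' = Im w /\ 0 <= Re w' <= 1 /\ f w' = f w).
    { clear w Hw P n Hn. induction n as [|n IH]; intros w Hw Hr.
      - exists w. simpl in Hr. repeat split; auto; lra.
      - rewrite S_INR in Hr. destruct (Rle_dec 0 (Re w)) as [L|L].
        + exists w. repeat split; auto; lra.
        + destruct (IH (w + RtoC 1)%C) as [w' [A1 [A2 A3]]].
          * now rewrite Im_plus_R.
          * rewrite Re_plus_R. lra.
          * exists w'. rewrite Im_plus_R in A1. repeat split; try easy.
            now rewrite A3, H. }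
    apply (Q n); auto. lra.
Qed.

(** Composing with multiplication by [- Ci] turns horizontal segments into the vertical ones of
    [strip_mean_const], and the period 1 identifies their ends. *)
Lemma horizontal_mean_const p y1 y2 :
  0 < y1 -> 0 < y2 -> (forall w, 0 < Im w -> holo p w) ->
  (forall w, 0 < Im w -> p (w + 1)%C = p w) ->
  RInt (fun t => Im (p (t, y1))) 0 1 = RInt (fun t => Im (p (t, y2))) 0 1.
Proof.
  intros P1 P2 Hp Per.
  assert (Q : forall y1 y2, 0 < y1 -> y1 <= y2 ->
    RInt (fun t => Im (p (t, y1))) 0 1 = RInt (fun t => Im (p (t, y2))) 0 1).
  { clear y1 y2 P1 P2. intros y1 y2 P1 L.
    assert (E : forall s t, (- Ci * (s, t))%C = (t, - s))
      by (intros; unfold Cmult, Copp, Ci; simpl; f_equal; ring).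
    assert (S := strip_mean_const (fun z => p (- Ci * z)%C) (- y2) (- y1) 1).
    cbv beta in S.
    rewrite (RInt_ext (fun t => Im (p (t, y1))) (fun t => Im (p (- Ci * ((- y1)%R, t))%C)))
      by (intros; now rewrite E, Ropp_involutive).
    rewrite (RInt_ext (fun t => Im (p (t, y2))) (fun t => Im (p (- Ci * ((- y2)%R, t))%C)))
      by (intros; now rewrite E, Ropp_involutive).
    apply S; try lra.
    - intros [s t] Hz. simpl in Hz. apply (holo_comp p (fun z => - Ci * z)%C).
      + apply holo_mult; auto using holo_const, holo_id.
      + apply Hp. rewrite E. simpl. lra.
    - intros s Hs. rewrite !E. rewrite <- (Per (0, - s)).
      + f_equal. unfold Cplus; simpl. f_equal; ring.
      + simpl. lra. }
  destruct (Rle_dec y1 y2); [apply Q; lra|symmetry; apply Q; lra].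
Qed.

(* Schwarz-Pick and periodicity make [Im p] comparable with its mean over a
   period, which does not depend on the height. *)
Lemma periodic_half_plane_bounds p y0 :
  (forall w, 0 < Im w -> holo p w) -> (forall w, 0 < Im w -> 0 < Im (p w)) ->
  (forall w, 0 < Im w -> p (w + 1)%C = p w) -> 0 < y0 ->
  exists m M, 0 < m /\ forall w, y0 <= Im w -> m <= Im (p w) /\ Cmod (p w) <= M.
Proof.
  intros Hp Pos Per Hy0.
  (* For points at the same height [y >= y0] and at distance [t <= 1], the distance from one to the
     conjugate of the other is at least [t * q]. Schwarz-Pick then reads [D * q <= D + 2 * u],
     whence [K = 2 / (q - 1)]. *)
  set (q := sqrt (1 + 4 * y0 ^ 2)).
  assert (Hq2 : q ^ 2 = 1 + 4 * y0 ^ 2) by (apply pow2_sqrt; nra).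
  assert (Hq : 1 < q).
  { unfold q. rewrite <- sqrt_1 at 1. apply sqrt_lt_1; nra. }
  set (K := 2 / (q - 1)).
  assert (HK : 0 < K) by (apply Rdiv_lt_0_compat; lra).
  assert (Har : forall y x x', y0 <= y -> 0 <= x <= 1 -> 0 <= x' <= 1 ->
    Cmod (p (x, y) - p (x', y)) <= K * Im (p (x', y))).
  { intros y x x' Hy Hx Hx'.
    assert (S := schwarz_pick_half_closed p (x, y) (x', y) Hp
       (fun w Hw => Rlt_le _ _ (Pos w Hw)) ltac:(simpl; lra) ltac:(simpl; lra)).
    set (t := Rabs (x - x')).
    assert (Ht : 0 <= t <= 1).
    { split; [apply Rabs_pos|]. apply Rabs_le. lra. }
    assert (Et : t ^ 2 = (x - x') ^ 2) by apply pow2_abs.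
    assert (E1 : Cmod ((x, y) - (x', y))%C = t).
    { replace ((x, y) - (x', y))%C with (RtoC (x - x')).
      - apply Cmod_R.
      - unfold RtoC, Cminus, Cplus, Copp; simpl. f_equal; ring. }
    assert (E2 : t * q <= Cmod ((x, y) - Cconj (x', y))%C).
    { apply Rsqr_incr_0; [|apply Rmult_le_pos; lra|apply Cmod_ge_0].
      rewrite !Rsqr_pow2, Cmod2_alt. simpl.
      assert ((t * q) ^ 2 = t ^ 2 * (1 + 4 * y0 ^ 2)) by (rewrite <- Hq2; ring).
      assert (t ^ 2 * y0 ^ 2 <= 1 * y ^ 2) by (apply Rmult_le_compat; nra). nra. }
    assert (Hu := Pos (x', y) ltac:(simpl; lra)).
    assert (B := Cmod_sub_conj_le (p (x, y)) (p (x', y)) ltac:(lra)).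
    set (D := Cmod (p (x, y) - p (x', y))) in *.
    assert (HD : 0 <= D) by apply Cmod_ge_0.
    set (u := Im (p (x', y))) in *. rewrite E1 in S.
    destruct (Req_dec t 0) as [T0|T0].
    { assert (x = x').
      { assert (X : (x - x') ^ 2 = 0) by (rewrite <- Et, T0; ring).
        destruct (Req_dec (x - x') 0); [lra|]. exfalso. revert X. now apply pow_nonzero. }
      subst x'. unfold D. rewrite Cminus_refl, Cmod_0. apply Rmult_le_pos; lra. }
    assert (S2 : t * (D * q) <= t * (D + 2 * u)).
    { apply Rle_trans with (D * Cmod ((x, y) - Cconj (x', y))%C).
      - replace (t * (D * q)) with (D * (t * q)) by ring. apply Rmult_le_compat_l; auto.
      - eapply Rle_trans; [exact S|]. apply Rmult_le_compat_l; lra. }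
    apply Rmult_le_reg_l in S2; [|lra].
    apply Rmult_le_reg_r with (q - 1); [lra|]. unfold K.
    replace (2 / (q - 1) * u * (q - 1)) with (2 * u) by (field; lra). lra. }
  set (A := RInt (fun t => Im (p (t, y0))) 0 1).
  (* Its imaginary part is [Re p], so the real part of [p] also has a mean independent of the
     height; this is what bounds [Cmod (p w)] and not only [Im (p w)]. *)
  pose (ip := fun w => (Ci * p w)%C).
  assert (Eip : forall w, Im (ip w) = Re (p w)) by (intros w; unfold ip; destruct (p w); simpl; ring).
  assert (Hip : forall w, 0 < Im w -> holo ip w) by (intros; apply holo_mult; auto using holo_const).
  set (B := RInt (fun t => Im (ip (t, y0))) 0 1).
  assert (Ex : forall f y, (forall w, 0 < Im w -> holo f w) -> 0 < y ->
    ex_RInt (fun t => Im (f (t, y))) 0 1).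
  { intros f y Hf Hy. apply ex_RInt_ext with (fun t => Re (- Ci * f (t, y))%C).
    { intros t _. now rewrite <- Im_Re_mul. }
    apply (ex_RInt_Re_h (fun w => - Ci * f w)%C); [lra|]. intros x _.
    apply cont_at_mult; [apply cont_at_const|]. apply holo_cont, Hf. easy. }
  assert (MA : forall y, y0 <= y -> RInt (fun t => Im (p (t, y))) 0 1 = A)
    by (intros; apply horizontal_mean_const; auto; lra).
  assert (MB : forall y, y0 <= y -> RInt (fun t => Im (ip (t, y))) 0 1 = B).
  { intros; apply horizontal_mean_const; auto; try lra. intros; unfold ip; now rewrite Per. }
  assert (Up : forall f y k, (forall w, 0 < Im w -> holo f w) -> 0 < y ->
    (forall x, 0 <= x <= 1 -> Im (f (x, y)) <= k) -> RInt (fun t => Im (f (t, y))) 0 1 <= k).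
  { intros f y k Hf Hy Hk. replace k with (RInt (fun _ => k) 0 1)
      by (rewrite RInt_const; unfold scal; simpl; unfold mult; simpl; ring).
    apply RInt_le; [lra|now apply Ex|apply ex_RInt_const|]. intros; apply Hk; lra. }
  assert (Lo : forall f y k, (forall w, 0 < Im w -> holo f w) -> 0 < y ->
    (forall x, 0 <= x <= 1 -> k <= Im (f (x, y))) -> k <= RInt (fun t => Im (f (t, y))) 0 1).
  { intros f y k Hf Hy Hk. replace k with (RInt (fun _ => k) 0 1)
      by (rewrite RInt_const; unfold scal; simpl; unfold mult; simpl; ring).
    apply RInt_le; [lra|apply ex_RInt_const|now apply Ex|]. intros; apply Hk; lra. }
  assert (Imd : forall y x x', y0 <= y -> 0 <= x <= 1 -> 0 <= x' <= 1 ->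
    Im (p (x, y)) <= (1 + K) * Im (p (x', y))).
  { intros y x x' Hy Hx Hx'. specialize (Har y x x' Hy Hx Hx').
    assert (Z := Rle_trans _ _ _ (Rabs_Im_le _) Har). apply Rabs_le_between in Z.
    change (Im (p (x, y) - p (x', y))%C) with (Im (p (x, y)) - Im (p (x', y))) in Z. lra. }
  assert (F1 : forall y x, y0 <= y -> 0 <= x <= 1 ->
     Im (p (x, y)) <= (1 + K) * A /\ A <= (1 + K) * Im (p (x, y))).
  { intros y x Hy Hx. rewrite <- (MA y Hy). split.
    - apply Rmult_le_reg_l with (/ (1 + K)); [apply Rinv_0_lt_compat; lra|].
      rewrite <- Rmult_assoc, Rinv_l, Rmult_1_l by lra.
      apply Lo; auto; [lra|]. intros x' Hx'.
      apply Rmult_le_reg_l with (1 + K); [lra|].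
      rewrite <- Rmult_assoc, Rinv_r, Rmult_1_l by lra. now apply Imd.
    - apply Up; auto; lra. }
  assert (HA : 0 < A).
  { assert (Q := Pos (0, y0) ltac:(simpl; lra)). destruct (F1 y0 0); try lra. nra. }
  set (k2 := K * ((1 + K) * A)).
  assert (F2 : forall y x, y0 <= y -> 0 <= x <= 1 -> Rabs (Re (p (x, y)) - B) <= k2).
  { intros y x Hy Hx. rewrite <- (MB y Hy).
    assert (Z : forall x', 0 <= x' <= 1 -> Re (p (x, y)) - k2 <= Re (p (x', y)) <= Re (p (x, y)) + k2).
    { intros x' Hx'. specialize (Har y x x' Hy Hx Hx').
      assert (Z := Rle_trans _ _ _ (re_le_Cmod _) Har). apply Rabs_le_between in Z.
      rewrite Re_minus in Z. destruct (F1 y x' Hy Hx') as [F _].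
      assert (K * Im (p (x', y)) <= k2) by (apply Rmult_le_compat_l; lra). lra. }
    apply Rabs_le. split.
    - enough (RInt (fun t => Im (ip (t, y))) 0 1 <= Re (p (x, y)) + k2) by lra.
      apply Up; auto; [lra|]. intros; rewrite Eip; now apply Z.
    - enough (Re (p (x, y)) - k2 <= RInt (fun t => Im (ip (t, y))) 0 1) by lra.
      apply Lo; auto; [lra|]. intros; rewrite Eip; now apply Z. }
  exists (A / (1 + K)), (Rabs B + k2 + (1 + K) * A). split; [apply Rdiv_lt_0_compat; lra|].
  intros w Hw. destruct (reduce_period p Per w ltac:(lra)) as [[x y] [Ey [Hx Ep]]].
  simpl in Ey, Hx. rewrite <- Ep. destruct (F1 y x) as [G1 G2]; [lra|lra|].
  assert (G3 := F2 y x ltac:(lra) Hx). assert (G4 := Pos (x, y) ltac:(simpl; lra)). split.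
  - apply Rle_div_l; lra.
  - eapply Rle_trans; [apply Cmod_le_Re_Im|]. rewrite (Rabs_pos_eq (Im _)) by lra.
    generalize (Rabs_triang (Re (p (x, y)) - B) B).
    replace (Re (p (x, y)) - B + B) with (Re (p (x, y))) by ring. lra.
Qed.

Lemma rect_bounded F a b c d :
  (forall z, a <= Re z <= b -> c <= Im z <= d -> cont_at F z) ->
  exists B, forall z, a <= Re z <= b -> c <= Im z <= d -> Cmod (F z) <= B.
Proof.
  intros HF. destruct (classic (exists z, a <= Re z <= b /\ c <= Im z <= d)) as [Ne|E].
  - destruct (compact_max (fun z => a <= Re z <= b /\ c <= Im z <= d)
       (fun z => F z * Cconj (F z))%C a b c d) as [z [Hz Mz]]; auto.
    + intros z Nz. apply NNPP. intros N.
      assert (Far : forall r, 0 < r -> exists w, Cmod (w - z) < r /\ a <= Re w <= b /\ c <= Im w <= d).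
      { intros r Hr. apply NNPP. intros N'. apply N. exists r; split; [easy|].
        intros w Hw H. apply N'. now exists w. }
      assert (Ab : forall x y, (forall r, 0 < r -> x <= y + r) -> x <= y).
      { intros x y H. apply Rnot_lt_le. intros L. specialize (H ((x - y) / 2)). lra. }
      assert (Co : forall r, 0 < r -> exists w, Rabs (Re w - Re z) <= r /\ Rabs (Im w - Im z) <= r /\
                a <= Re w <= b /\ c <= Im w <= d).
      { intros r Hr. destruct (Far r Hr) as [w [Hw H]]. exists w.
        generalize (re_le_Cmod (w - z)) (Rabs_Im_le (w - z)). rewrite Re_minus.
        change (Im (w - z)%C) with (Im w - Im z). intuition lra. }
      apply Nz. repeat split; apply Ab; intros r Hr; destruct (Co r Hr) as [w [A1 [A2 H]]];
        apply Rabs_le_between in A1; apply Rabs_le_between in A2; lra.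
    + intros z [H1 H2]. apply cont_at_mult; [auto|].
      apply (cont_at_comp Cconj F); auto using cont_at_conj.
    + exists (Cmod (F z)). intros w H1 H2. apply Cmod_le_of_sqr.
      rewrite <- !Cmod_sqr_re. auto.
  - exists 0. intros z H1 H2. elim E. now exists z.
Qed.

(** * Half-plane maps commuting with the unit translation *)

Definition half_plane_map (Psi : C -> C) : Prop :=
  (forall w, 0 < Im w -> holo Psi w) /\ (forall w, 0 < Im w -> 0 < Im (Psi w)) /\
  (forall w, 0 < Im w -> Psi (w + 1)%C = (Psi w + 1)%C).

Lemma half_plane_map_Im_le Psi w : half_plane_map Psi -> 0 < Im w -> Im w <= Im (Psi w).
Proof.
  intros [Hh [Hi Ht]] Hw.
  assert (S := schwarz_pick_half_half Psi (w + 1)%C w Hh Hi Hw).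
  rewrite Ht in S by easy.
  replace (Psi w + 1 - Psi w)%C with (RtoC 1) in S by ring.
  replace (w + 1 - w)%C with (RtoC 1) in S by ring.
  rewrite Cmod_1, !Rmult_1_l in S.
  assert (Hw' : 0 < Im (w + 1)%C) by (rewrite Im_plus_R; easy). specialize (S Hw').
  assert (S2 := pow_incr _ _ 2 (conj (Cmod_ge_0 _) S)). rewrite !Cmod_shift_conj in S2.
  specialize (Hi w Hw). nra.
Qed.

(** The function [Psi w - w] has nonnegative imaginary part and a real value at [a]. That value is
    its own conjugate, so Schwarz-Pick bounds [X * Cmod (w - Cconj a)] by [X * Cmod (w - a)], where
    [X] is the distance between the values at [w] and [a]; since [w] is closer to [a], [X] is 0. *)
Lemma half_plane_map_rigid Psi a :
  half_plane_map Psi -> 0 < Im a -> Im (Psi a) = Im a ->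
  forall w, 0 < Im w -> (Psi w - w = Psi a - a)%C.
Proof.
  intros HP Ha E w Hw.
  assert (S := schwarz_pick_half_closed (fun w => Psi w - w)%C w a). cbv beta in S.
  assert (R : Cconj (Psi a - a) = (Psi a - a)%C).
  { destruct (Psi a), a. simpl in E. unfold Cconj, Cminus, Cplus, Copp; simpl. f_equal. lra. }
  rewrite R in S.
  assert (L := half_plane_conj_lt w a Hw Ha).
  apply Cmod_eq. apply Rnot_lt_le. intros P.
  assert (Cmod (Psi w - w - (Psi a - a)) * Cmod (w - Cconj a) <=
          Cmod (w - a) * Cmod (Psi w - w - (Psi a - a))); [|nra].
  apply S; auto.
  - intros v Hv. apply holo_minus; auto using holo_id. now apply HP.
  - intros v Hv. change (Im (Psi v - v)%C) with (Im (Psi v) - Im v).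
    generalize (half_plane_map_Im_le Psi v HP Hv). lra.
Qed.

Lemma half_plane_map_bounds Psi y0 :
  half_plane_map Psi -> (forall w, 0 < Im w -> Im w < Im (Psi w)) -> 0 < y0 ->
  exists m M, 0 < m /\ 0 < M /\ forall w, y0 <= Im w ->
    Im w + m <= Im (Psi w) <= Im w + M /\ Cmod (Psi w - w) <= M.
Proof.
  intros [Hh [Hi Ht]] Hs Hy.
  destruct (periodic_half_plane_bounds (fun w => Psi w - w)%C y0) as [m [M [Hm H]]]; auto.
  - intros w Hw. apply holo_minus; auto using holo_id.
  - intros w Hw. change (Im (Psi w - w)%C) with (Im (Psi w) - Im w). specialize (Hs w Hw). lra.
  - intros w Hw. rewrite Ht by easy. ring.
  - exists m, M. split; [easy|].
    assert (Q : forall w, y0 <= Im w -> Im w + m <= Im (Psi w) <= Im w + M /\ Cmod (Psi w - w) <= M).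
    { intros w Hw. destruct (H w Hw) as [H1 H2].
      change (Im (Psi w - w)%C) with (Im (Psi w) - Im w) in H1.
      assert (H3 := Rle_trans _ _ _ (Rabs_Im_le _) H2). apply Rabs_le_between in H3.
      change (Im (Psi w - w)%C) with (Im (Psi w) - Im w) in H3. split; [lra|easy]. }
    split; [|easy]. specialize (Q (0, y0)%R (Rle_refl y0)). lra.
Qed.

(** [Psi] moves points by at most [M], so on the circle of radius [2 * M + 1] about [v] it stays at
    distance at least [M + 1] from [v], but only at most [M] at the centre. The hypothesis on [Im v]
    keeps the disc above height [Y]. *)
Lemma half_plane_map_surjective Psi m M Y v :
  half_plane_map Psi -> 0 < Y -> 0 < m -> 0 < M ->
  (forall w, Y <= Im w ->
    Im w + m <= Im (Psi w) <= Im w + M /\ Cmod (Psi w - w) <= M) ->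
  Y + (2 * M + 1) <= Im v -> exists w, 0 < Im w /\ Psi w = v /\ Im v - M <= Im w <= Im v - m.
Proof.
  intros HP HY Hm HM HB Hv.
  assert (Near : forall w, Cmod (w - v) <= 2 * M + 1 -> Y <= Im w).
  { intros w Hw. assert (X := Rle_trans _ _ _ (Rabs_Im_le _) Hw). apply Rabs_le_between in X.
    change (Im (w - v)%C) with (Im w - Im v) in X. lra. }
  destruct (zero_in_disc (fun w => Psi w - v)%C v (2 * M + 1) (M + 1)) as [w [Hw E]].
  - lra.
  - intros w Hw. apply holo_minus; auto using holo_const. apply HP. specialize (Near w Hw). lra.
  - intros w Hw. destruct (HB w (Near w (Req_le _ _ Hw))) as [_ B].
    replace (Psi w - v)%C with ((w - v) - (w - Psi w))%C by ring.
    generalize (Cmod_sub_ge (w - v) (w - Psi w)). rewrite (Cmod_sub_sym w (Psi w)). lra.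
  - destruct (HB v) as [_ B]; [|lra]. apply Near. rewrite Cminus_refl, Cmod_0. lra.
  - apply Cminus_eq_0 in E. exists w. specialize (Near w (Rlt_le _ _ Hw)).
    destruct (HB w Near) as [B _]. rewrite E in B. repeat split; auto; lra.
Qed.

(* If [Im c = 0] then [Im beta] descends to the quotient of a high half-plane by
   [Psi] and [w + 1]; it is therefore bounded there, although [beta] is
   unbounded along horizontal lines, and Schwarz-Pick on large discs rules this out. *)
Lemma abel_coeff_nonreal Psi beta c :
  half_plane_map Psi -> (forall w, 0 < Im w -> Im w < Im (Psi w)) ->
  (forall w, 0 < Im w -> holo beta w) ->
  (forall w, 0 < Im w -> beta (w + 1)%C = (beta w + 1)%C) ->
  (forall w, 0 < Im w -> beta (Psi w) = (beta w + c)%C) ->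
  Im c <> 0.
Proof.
  intros HP Hs Hb Hb1 HbP Hc.
  destruct (half_plane_map_bounds Psi 1 HP Hs Rlt_0_1) as [m [M [Hm [HM HB]]]].
  set (Y := 1 + (2 * M + 1)).
  assert (Back : forall v, Y <= Im v -> exists w, 0 < Im w /\ Im v - M <= Im w <= Im v - m /\
            Im (beta w) = Im (beta v)).
  { intros v Hv. destruct (half_plane_map_surjective Psi m M 1 v) as [w [Hw [E L]]]; auto; [lra|].
    exists w. repeat split; try easy. rewrite <- E, HbP by easy.
    change (Im (beta w + c)%C) with (Im (beta w) + Im c). lra. }
  (* Each backward step lowers the height by at least [m] and at most [M], so the descent ends and
     cannot jump over the band of width [M] above [Y]. *)
  assert (Desc : forall n v, Y <= Im v <= Y + M + INR n * m ->
            exists w, Y <= Im w <= Y + M /\ Im (beta w) = Im (beta v)).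
  { induction n as [|n IH]; intros v Hv.
    - exists v. simpl in Hv. split; [lra|easy].
    - rewrite S_INR in Hv. destruct (Rle_dec (Im v) (Y + M)).
      + exists v. split; [lra|easy].
      + destruct (Back v) as [w [Hw [L E]]]; [lra|].
        destruct (IH w) as [w' [H1 H2]]; [lra|]. exists w'. split; [easy|congruence]. }
  destruct (rect_bounded beta 0 1 Y (Y + M)) as [B HBd].
  { intros z _ Hz. apply holo_cont, Hb. unfold Y in Hz; lra. }
  assert (Bd : forall v, Y <= Im v -> Rabs (Im (beta v)) <= B).
  { intros v Hv. destruct (INR_unbounded ((Im v - (Y + M)) / m)) as [n Hn].
    assert (Im v - (Y + M) <= INR n * m).
    { apply Rlt_le. apply Rmult_lt_reg_r with (/ m); [now apply Rinv_0_lt_compat|].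
      rewrite (Rmult_assoc (INR n)), Rinv_r, Rmult_1_r by lra. exact Hn. }
    destruct (Desc n v) as [w [Hw <-]]; [lra|].
    destruct (reduce_period (fun w => Im (beta w))) with (w := w) as [w' [H1 [H2 <-]]].
    - intros u Hu. rewrite Hb1 by easy. apply Im_plus_R.
    - unfold Y in Hw; lra.
    - eapply Rle_trans; [apply Rabs_Im_le|]. apply HBd; lra. }
  assert (HB0 : 0 <= B) by (eapply Rle_trans; [apply Rabs_pos|apply (Bd (0, Y)); simpl; lra]).
  (* The shift of [beta] by [i (B + 1)] has imaginary part at most [2 * B + 1] at [v]. Schwarz-Pick
     for [v] and [v + 1] on the disc of radius [R] then gives
     [R <= 1 + 2 * (2 * B + 1) = 4 * B + 3]. *)
  set (R := 4 * B + 4). set (v := (0, Y + R)%R : C).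
  assert (Ball : forall w, Cmod (w - v) < R -> Y <= Im w).
  { intros w Hw. assert (X := Rle_lt_trans _ _ _ (Rabs_Im_le _) Hw). apply Rabs_lt_between in X.
    change (Im (w - v)%C) with (Im w - (Y + R)) in X. lra. }
  assert (YP : 0 < Y) by (unfold Y; lra).
  assert (S := schwarz_pick_ball_half (fun w => beta w + Ci * RtoC (B + 1))%C v R (v + 1)%C).
  cbv beta in S.
  assert (EI : forall w, Im (beta w + Ci * RtoC (B + 1))%C = Im (beta w) + (B + 1)).
  { intros w. destruct (beta w). simpl. ring. }
  assert (Hv : Y <= Im v) by (simpl; unfold R; lra).
  assert (Q1 : (v + 1 - v)%C = RtoC 1) by ring.
  rewrite Q1, Hb1, Cmod_1 in S by lra.
  replace (beta v + 1 + Ci * RtoC (B + 1) - (beta v + Ci * RtoC (B + 1)))%C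
    with (RtoC 1) in S by ring.
  rewrite Cmod_1, Rmult_1_r, Rmult_1_l in S.
  set (b := (beta v + Ci * RtoC (B + 1))%C) in *.
  replace (beta v + 1 + Ci * RtoC (B + 1))%C with (b + 1)%C in S by (unfold b; ring).
  assert (Eb : 0 <= Im b <= 2 * B + 1).
  { unfold b. rewrite EI. specialize (Bd v Hv). apply Rabs_le_between in Bd. lra. }
  assert (Q2 := Cmod_sub_conj_le (b + 1)%C b (proj1 Eb)).
  replace (b + 1 - b)%C with (RtoC 1) in Q2 by ring. rewrite Cmod_1 in Q2.
  assert (R <= Cmod (b + 1 - Cconj b)); [|unfold R in *; lra].
  apply S.
  - intros w Hw. apply holo_plus; auto using holo_const. apply Hb. specialize (Ball w Hw). lra.
  - intros w Hw. rewrite EI. specialize (Bd w (Ball w Hw)). apply Rabs_le_between in Bd. lra.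
  - unfold R; lra.
Qed.

(** Along the line of height 1, [Im beta] has period 1 and is bounded, while [n] translations by [a]
    add [n * Im c] to it. *)
Lemma abel_coeff_real beta a c :
  (forall w, 0 < Im w -> holo beta w) ->
  (forall w, 0 < Im w -> beta (w + 1)%C = (beta w + 1)%C) ->
  (forall w, 0 < Im w -> beta (w + RtoC a)%C = (beta w + c)%C) ->
  Im c = 0.
Proof.
  intros Hb Hb1 Hba.
  destruct (rect_bounded beta 0 1 1 1) as [B HB].
  { intros z _ Hz. apply holo_cont, Hb. lra. }
  assert (Bd : forall x, Rabs (Im (beta (x, 1))) <= B).
  { intros x. destruct (reduce_period (fun w => Im (beta w))) with (w := (x, 1) : C)
      as [w' [H1 [H2 <-]]].
    - intros u Hu. rewrite Hb1 by easy. apply Im_plus_R.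
    - simpl; lra.
    - simpl in H1. eapply Rle_trans; [apply Rabs_Im_le|]. apply HB; lra. }
  assert (It : forall n, Im (beta (INR n * a, 1)) = Im (beta (0, 1)) + INR n * Im c).
  { induction n as [|n IH].
    - simpl. rewrite !Rmult_0_l. ring.
    - rewrite S_INR. replace ((INR n + 1) * a, 1)%R with ((INR n * a, 1)%R + RtoC a)%C
        by (unfold Cplus, RtoC; simpl; f_equal; ring).
      rewrite Hba by (simpl; lra).
      change (Im (beta (INR n * a, 1)%R + c)%C) with (Im (beta (INR n * a, 1)%R) + Im c).
      rewrite IH. ring. }
  destruct (Req_dec (Im c) 0) as [|N]; [easy|exfalso].
  apply Rabs_pos_lt in N.
  destruct (INR_unbounded (2 * B / Rabs (Im c))) as [n Hn].
  apply Rlt_div_l in Hn; [|easy].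
  assert (X := Bd (INR n * a)). assert (Y := Bd 0). rewrite It in X.
  assert (Z : Rabs (INR n * Im c) <= 2 * B).
  { replace (INR n * Im c) with ((Im (beta (0, 1)) + INR n * Im c) - Im (beta (0, 1))) by ring.
    eapply Rle_trans; [apply Rabs_triang|]. rewrite Rabs_Ropp. lra. }
  rewrite Rabs_mult, (Rabs_pos_eq (INR n)) in Z by apply pos_INR. lra.
Qed.

Lemma half_plane_map_escape Psi w T :
  half_plane_map Psi -> (forall w, 0 < Im w -> Im w < Im (Psi w)) -> 0 < Im w ->
  exists n, T <= Im (Nat.iter n Psi w).
Proof.
  intros HP Hs Hw. destruct (half_plane_map_bounds Psi (Im w) HP Hs Hw) as [m [M [Hm [_ HB]]]].
  assert (G : forall n, Im w + INR n * m <= Im (Nat.iter n Psi w)).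
  { induction n as [|n IH]; [simpl; lra|]. rewrite S_INR. simpl.
    assert (0 <= INR n * m) by (apply Rmult_le_pos; [apply pos_INR|lra]).
    destruct (HB (Nat.iter n Psi w)) as [B _]; lra. }
  destruct (INR_unbounded ((T - Im w) / m)) as [n Hn]. exists n.
  specialize (G n). apply Rlt_div_l in Hn; lra.
Qed.

(** * Hyperbolic steps and the model *)

Definition disc_map (f : C -> C) : Prop :=
  (forall z, Cmod z < 1 -> holo f z) /\ (forall z, Cmod z < 1 -> Cmod (f z) < 1).

Lemma pseudo_hyperbolic_mult z w :
  Cmod z < 1 -> Cmod w < 1 ->
  pseudo_hyperbolic z w * Cmod (1 - Cconj w * z) = Cmod (z - w).
Proof.
  intros Hz Hw. assert (N := Cmod_lt_neq_0 _ _ (disc_mobius_lt z w Hz Hw)).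
  unfold pseudo_hyperbolic. rewrite Cmod_div by easy. field.
  apply Cmod_gt_0 in N. lra.
Qed.

Lemma pseudo_hyperbolic_bounds z w :
  Cmod z < 1 -> Cmod w < 1 -> 0 <= pseudo_hyperbolic z w < 1.
Proof.
  intros Hz Hw. split; [apply Cmod_ge_0|].
  assert (L := disc_mobius_lt z w Hz Hw).
  rewrite <- (pseudo_hyperbolic_mult z w Hz Hw) in L. generalize (Cmod_ge_0 (1 - Cconj w * z)). nra.
Qed.

Lemma pseudo_hyperbolic_le z w K X :
  Cmod z < 1 -> Cmod w < 1 -> 0 < K -> K * Cmod (z - w) <= X * Cmod (1 - Cconj w * z) ->
  K * pseudo_hyperbolic z w <= X.
Proof.
  intros Hz Hw HK H. rewrite <- (pseudo_hyperbolic_mult z w Hz Hw), <- Rmult_assoc in H.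
  apply Rmult_le_reg_r in H; [easy|].
  generalize (disc_mobius_lt z w Hz Hw) (Cmod_ge_0 (z - w)). lra.
Qed.

Lemma pseudo_hyperbolic_contract f z w :
  disc_map f -> Cmod z < 1 -> Cmod w < 1 ->
  pseudo_hyperbolic (f z) (f w) <= pseudo_hyperbolic z w.
Proof.
  intros [Hh Hd] Hz Hw. rewrite <- (Rmult_1_l (pseudo_hyperbolic (f z) (f w))).
  apply pseudo_hyperbolic_le; auto; [lra|].
  assert (S := schwarz_pick_disc_disc f z w Hh Hd Hw Hz).
  rewrite <- (pseudo_hyperbolic_mult z w Hz Hw) in S.
  apply Rmult_le_reg_r with (Cmod (1 - Cconj w * z)).
  - generalize (disc_mobius_lt z w Hz Hw) (Cmod_ge_0 (z - w)). lra.
  - lra.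
Qed.

Lemma artanh_le s t :
  0 <= s <= t -> t < 1 -> / 2 * ln ((1 + s) / (1 - s)) <= / 2 * ln ((1 + t) / (1 - t)).
Proof.
  intros Hs Ht. apply Rmult_le_compat_l; [lra|]. apply ln_le.
  - apply Rdiv_lt_0_compat; lra.
  - apply Rmult_le_compat; try lra.
    + left. apply Rinv_0_lt_compat; lra.
    + apply Rinv_le_contravar; lra.
Qed.

Lemma artanh_pos s : 0 < s < 1 -> 0 < / 2 * ln ((1 + s) / (1 - s)).
Proof.
  intros Hs. apply Rmult_lt_0_compat; [lra|]. rewrite <- ln_1. apply ln_increasing; [lra|].
  apply Rlt_div_r; lra.
Qed.

Lemma artanh_le_linear s : 0 <= s <= / 2 -> / 2 * ln ((1 + s) / (1 - s)) <= 2 * s.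
Proof.
  intros Hs.
  assert (P : 0 < (1 + s) / (1 - s)) by (apply Rdiv_lt_0_compat; lra).
  assert (L : ln ((1 + s) / (1 - s)) <= (1 + s) / (1 - s) - 1).
  { generalize (exp_ineq1_le (ln ((1 + s) / (1 - s)))). rewrite exp_ln by easy. lra. }
  assert ((1 + s) / (1 - s) - 1 <= 4 * s); [|lra].
  replace ((1 + s) / (1 - s) - 1) with (2 * s * / (1 - s)) by (field; lra).
  assert (/ (1 - s) <= 2).
  { rewrite <- (Rinv_inv 2). apply Rinv_le_contravar; lra. }
  assert (0 < / (1 - s)) by (apply Rinv_0_lt_compat; lra). nra.
Qed.

Lemma disc_map_iterate f n z : disc_map f -> Cmod z < 1 -> Cmod (iterate f n z) < 1.
Proof. intros [_ H] Hz. induction n; simpl; auto. Qed.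

Lemma iterate_contract f n z w :
  disc_map f -> Cmod z < 1 -> Cmod w < 1 ->
  pseudo_hyperbolic (iterate f n z) (iterate f n w) <= pseudo_hyperbolic z w.
Proof.
  intros Hf Hz Hw. induction n as [|n IH]; [simpl; lra|]. simpl.
  eapply Rle_trans; [|exact IH].
  apply pseudo_hyperbolic_contract; auto; now apply (disc_map_iterate f n).
Qed.

Lemma iterate_plus f n m z : iterate f (n + m) z = iterate f n (iterate f m z).
Proof. unfold iterate. apply Nat.iter_add. Qed.

Lemma iterate_succ_r f n z : iterate f (S n) z = iterate f n (f z).
Proof. unfold iterate. apply Nat.iter_succ_r. Qed.

(** By Schwarz-Pick the steps decrease along the orbit, so their limit exists, and the uniform lower
    bound passes to it. *)
Lemma positive_step_intro f z s :
  disc_map f -> Cmod z < 1 -> 0 < s ->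
  (forall n, s <= pseudo_hyperbolic (iterate f n z) (iterate f (S n) z)) ->
  positive_hyperbolic_step f.
Proof.
  intros Hf Hz Hs H.
  set (u := fun n => hyperbolic_dist (iterate f n z) (iterate f (S n) z)).
  assert (In := fun n => disc_map_iterate f n z Hf Hz).
  assert (Bd := fun n => pseudo_hyperbolic_bounds _ _ (In n) (In (S n))).
  assert (Lo : forall n, / 2 * ln ((1 + s) / (1 - s)) <= u n).
  { intros n. apply artanh_le; [|apply Bd]. specialize (H n). lra. }
  destruct (ex_finite_lim_seq_decr u (/ 2 * ln ((1 + s) / (1 - s)))) as [l Hl]; auto.
  - intros n. apply artanh_le; [|apply Bd]. split; [apply Bd|].
    apply (pseudo_hyperbolic_contract f); auto; apply In.
  - exists z, l. repeat split; auto.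
    apply Rlt_le_trans with (/ 2 * ln ((1 + s) / (1 - s))).
    + apply artanh_pos. specialize (H 0%nat). specialize (Bd 0%nat). lra.
    + exact (is_lim_seq_le (fun _ => / 2 * ln ((1 + s) / (1 - s))) u (Finite _) (Finite l)
               Lo (is_lim_seq_const _) Hl).
Qed.

Lemma zero_step_intro f :
  disc_map f ->
  (forall z eps, Cmod z < 1 -> 0 < eps -> exists N, forall n, (N <= n)%nat ->
     pseudo_hyperbolic (iterate f n z) (iterate f (S n) z) <= eps) ->
  ~ positive_hyperbolic_step f.
Proof.
  intros Hf H [z [l [Hz [Hl Lim]]]].
  (* For arguments up to [/ 2] the inverse hyperbolic tangent is at most twice its argument, so the
     steps are eventually at most [l / 2]. *)
  set (e := Rmin (/ 2) (l / 4)).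
  assert (He : 0 < e) by (apply Rmin_pos; lra).
  assert (E1 : e <= / 2) by apply Rmin_l. assert (E2 : e <= l / 4) by apply Rmin_r.
  destruct (H z e Hz He) as [N HN].
  enough (Q : eventually (fun n => hyperbolic_dist (iterate f n z) (iterate f (S n) z) <= l / 2)).
  { assert (L := is_lim_seq_le_loc _ _ (Finite l) (Finite (l / 2)) Q Lim (is_lim_seq_const _)).
    simpl in L. lra. }
  exists N. intros n Hn.
  assert (B := pseudo_hyperbolic_bounds _ _ (disc_map_iterate f n z Hf Hz)
                 (disc_map_iterate f (S n) z Hf Hz)).
  specialize (HN n Hn). unfold hyperbolic_dist.
  eapply Rle_trans; [apply artanh_le_linear; lra|]. lra.
Qed.

Lemma iterate_comm f g n m z :
  disc_map f -> disc_map g -> (forall z, Cmod z < 1 -> g (f z) = f (g z)) -> Cmod z < 1 ->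
  iterate g m (iterate f n z) = iterate f n (iterate g m z).
Proof.
  intros Hf Hg Hc Hz.
  assert (One : forall n z, Cmod z < 1 -> g (iterate f n z) = iterate f n (g z)).
  { clear n z Hz. intros n z Hz. induction n as [|n IH]; simpl; [easy|].
    rewrite Hc by (now apply (disc_map_iterate f n)). now f_equal. }
  induction m as [|m IH]; simpl; [easy|].
  etransitivity; [apply f_equal, IH|]. apply One. now apply disc_map_iterate.
Qed.

Lemma iterate_compose f g n z :
  disc_map f -> disc_map g -> (forall z, Cmod z < 1 -> g (f z) = f (g z)) -> Cmod z < 1 ->
  iterate (fun z => f (g z)) n z = iterate f n (iterate g n z).
Proof.
  intros Hf Hg Hc Hz. induction n as [|n IH]; [easy|].
  change (f (g (iterate (fun z => f (g z)) n z)) = f (iterate f n (g (iterate g n z)))).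
  rewrite IH. f_equal.
  apply (iterate_comm f g n 1); auto. now apply disc_map_iterate.
Qed.

Lemma disc_map_comp f g : disc_map f -> disc_map g -> disc_map (fun z => f (g z)).
Proof.
  intros [Hf Bf] [Hg Bg]. split; [|auto]. intros z Hz. apply holo_comp; auto.
Qed.

(* A canonical model normalized to the upper half-plane: when the base space of
   the original model is the lower half-plane, [h] is replaced by [- h] and the
   translation by [1] becomes the translation by [sg = -1]. *)
Record translation_model (phi : C -> C) (sg : R) (h : C -> C) (V : C -> Prop) : Prop := {
  tm_sign : sg = 1 \/ sg = -1;
  tm_phi : disc_map phi;
  tm_holo : forall z, Cmod z < 1 -> holo h z;
  tm_Im : forall z, Cmod z < 1 -> 0 < Im (h z);
  tm_semiconj : forall z, Cmod z < 1 -> h (phi z) = (h z + RtoC sg)%C;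
  tm_exhaust : forall w, 0 < Im w ->
    exists (n : nat) (z : C), Cmod z < 1 /\ w = (h z - RtoC (INR n * sg))%C;
  tm_open : forall w, V w -> exists r, 0 < r /\ forall v, Cmod (v - w) < r -> V v;
  tm_disc : forall z, V z -> Cmod z < 1;
  tm_invariant : forall z, V z -> V (phi z);
  tm_absorbing : forall z, Cmod z < 1 -> exists n, V (iterate phi n z);
  tm_injective : forall z w, V z -> V w -> h z = h w -> z = w
}.

Lemma model_iterate phi sg h V n z :
  translation_model phi sg h V -> Cmod z < 1 ->
  h (iterate phi n z) = (h z + RtoC (INR n * sg))%C.
Proof.
  intros T Hz. induction n as [|n IH].
  - simpl. rewrite Rmult_0_l. ring.
  - rewrite S_INR. simpl. rewrite (tm_semiconj _ _ _ _ T) by (apply (disc_map_iterate phi n); [apply T|easy]).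
    etransitivity; [apply (f_equal (fun w => w + RtoC sg)%C), IH|].
    rewrite Rmult_plus_distr_r, RtoC_plus, Rmult_1_l. ring.
Qed.

Lemma model_eventually phi sg h V z :
  translation_model phi sg h V -> Cmod z < 1 ->
  exists N, forall n, (N <= n)%nat -> V (iterate phi n z).
Proof.
  intros T Hz. destruct (tm_absorbing _ _ _ _ T z Hz) as [N HN]. exists N.
  intros n Hn. induction Hn; [easy|]. simpl. now apply T.
Qed.

(** Injectivity of [h] is available only on [V]; both orbits enter [V] and stay there, while
    equality of the images under [h] persists. *)
Lemma model_eq_eventually phi sg h V z w :
  translation_model phi sg h V -> Cmod z < 1 -> Cmod w < 1 -> h z = h w ->
  exists N, V (iterate phi N z) /\ iterate phi N z = iterate phi N w.
Proof.
  intros T Hz Hw E.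
  destruct (model_eventually _ _ _ _ z T Hz) as [N1 H1].
  destruct (model_eventually _ _ _ _ w T Hw) as [N2 H2].
  exists (max N1 N2). split; [apply H1; lia|].
  apply (tm_injective _ _ _ _ T); [apply H1; lia|apply H2; lia|].
  now rewrite !(model_iterate _ _ _ _ _ _ T), E by easy.
Qed.

Lemma model_exhaust_V phi sg h V w :
  translation_model phi sg h V -> 0 < Im w ->
  exists n z, V z /\ h z = (w + RtoC (INR n * sg))%C.
Proof.
  intros T Hw. destruct (tm_exhaust _ _ _ _ T w Hw) as [n [z [Hz ->]]].
  destruct (tm_absorbing _ _ _ _ T z Hz) as [N HN].
  exists (N + n)%nat, (iterate phi N z). split; [easy|].
  rewrite (model_iterate _ _ _ _ _ _ T) by easy.
  rewrite plus_INR, Rmult_plus_distr_r, RtoC_plus. ring.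
Qed.

Lemma model_inverse phi sg h V :
  translation_model phi sg h V -> exists g, (forall z, V z -> g (h z) = z) /\
  forall z, V z -> holo g (h z) /\
    exists d, 0 < d /\ forall v, Cmod (v - h z) < d -> exists w, V w /\ h w = v.
Proof.
  intros T. pose (g := fun v => epsilon (inhabits (RtoC 0)) (fun z => V z /\ h z = v)).
  assert (Hg : forall z, V z -> g (h z) = z).
  { intros z Hz. destruct (epsilon_spec (inhabits (RtoC 0)) (fun w => V w /\ h w = h z)) as [Vw E].
    - now exists z.
    - now apply (tm_injective _ _ _ _ T). }
  exists g. split; [easy|]. intros z Hz. apply (injective_inverse V); auto.
  - apply T.
  - intros w Hw. apply T, (tm_disc _ _ _ _ T), Hw.
  - apply T.
Qed.

(** If [h z - n sg = h w - m sg], then the [m]-th iterate of [z] and the [n]-th iterate of [w] have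
    the same image under [h] and merge later; as [psi] commutes with iterates of [phi], the proposed
    values of [Psi] agree ([Key]). Holomorphy is local: one shift carries a neighbourhood of [w]
    into the image of [V], where [g] inverts [h]. *)
Lemma model_conjugate phi psi sg h V :
  translation_model phi sg h V -> disc_map psi ->
  (forall z, Cmod z < 1 -> psi (phi z) = phi (psi z)) ->
  exists Psi, half_plane_map Psi /\
    forall n z, Cmod z < 1 -> Psi (h z - RtoC (INR n * sg))%C = (h (psi z) - RtoC (INR n * sg))%C.
Proof.
  intros T Hpsi Hc.
  assert (Hphi := tm_phi _ _ _ _ T).
  assert (Hit : forall n z, Cmod z < 1 -> h (psi (iterate phi n z)) = (h (psi z) + RtoC (INR n * sg))%C).
  { intros n z Hz. assert (E := iterate_comm phi psi n 1 z Hphi Hpsi Hc Hz). simpl in E.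
    rewrite E. apply (model_iterate _ _ _ _ _ _ T). now apply Hpsi. }
  assert (Key : forall n m z w, Cmod z < 1 -> Cmod w < 1 ->
    (h z - RtoC (INR n * sg))%C = (h w - RtoC (INR m * sg))%C ->
    (h (psi z) - RtoC (INR n * sg))%C = (h (psi w) - RtoC (INR m * sg))%C).
  { intros n m z w Hz Hw E.
    assert (Hz' := disc_map_iterate phi m z Hphi Hz). assert (Hw' := disc_map_iterate phi n w Hphi Hw).
    destruct (model_eq_eventually _ _ _ _ (iterate phi m z) (iterate phi n w) T Hz' Hw')
      as [N [_ EN]].
    { rewrite !(model_iterate _ _ _ _ _ _ T) by easy.
      replace (h z) with ((h z - RtoC (INR n * sg)) + RtoC (INR n * sg))%C by ring.
      rewrite E. ring. }
    apply (f_equal (fun v => h (psi v))) in EN. rewrite !Hit in EN by easy.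
    replace (h (psi z)) with ((h (psi z) + RtoC (INR m * sg) + RtoC (INR N * sg))
       - RtoC (INR m * sg) - RtoC (INR N * sg))%C by ring.
    rewrite EN. ring. }
  pose (pre := fun w (q : nat * C) => Cmod (snd q) < 1 /\ w = (h (snd q) - RtoC (INR (fst q) * sg))%C).
  pose (Psi := fun w => let q := epsilon (inhabits (0%nat, RtoC 0)) (pre w) in
                        (h (psi (snd q)) - RtoC (INR (fst q) * sg))%C).
  assert (HP : forall n z, Cmod z < 1 ->
    Psi (h z - RtoC (INR n * sg))%C = (h (psi z) - RtoC (INR n * sg))%C).
  { intros n z Hz. unfold Psi.
    destruct (epsilon_spec (inhabits (0%nat, RtoC 0)) (pre (h z - RtoC (INR n * sg))%C)) as [A B].
    - exists (n, z). now split.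
    - symmetry. now apply Key. }
  exists Psi. split; [|exact HP]. split; [|split].
  - intros w Hw. destruct (model_exhaust_V _ _ _ _ w T Hw) as [n [z [Vz E]]].
    destruct (model_inverse _ _ _ _ T) as [g [Hg Hg']].
    destruct (Hg' z Vz) as [Gz [d [Hd Im]]].
    assert (Dz := tm_disc _ _ _ _ T z Vz).
    apply (holo_ext_loc (fun v => h (psi (g (v + RtoC (INR n * sg)))) - RtoC (INR n * sg))%C Psi w d Hd).
    + intros v Hv. destruct (Im (v + RtoC (INR n * sg))%C) as [u [Vu Eu]].
      { rewrite E. replace (v + RtoC (INR n * sg) - (w + RtoC (INR n * sg)))%C with (v - w)%C by ring. easy. }
      rewrite <- Eu, Hg by easy.
      replace v with (h u - RtoC (INR n * sg))%C by (rewrite Eu; ring).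
      symmetry. apply HP, (tm_disc _ _ _ _ T), Vu.
    + apply holo_minus; auto using holo_const.
      apply (holo_comp (fun u => h (psi u)) (fun v => g (v + RtoC (INR n * sg))%C)).
      * apply (holo_comp g (fun v => v + RtoC (INR n * sg))%C).
        -- apply holo_plus; auto using holo_const, holo_id.
        -- now rewrite <- E.
      * rewrite <- E, Hg by easy. apply holo_comp; [now apply Hpsi|]. apply T. now apply Hpsi.
  - intros w Hw. destruct (tm_exhaust _ _ _ _ T w Hw) as [n [z [Hz ->]]].
    rewrite HP by easy. unfold Cminus. rewrite <- RtoC_opp, Im_plus_R. apply T. now apply Hpsi.
  - intros w Hw. destruct (tm_exhaust _ _ _ _ T w Hw) as [n [z [Hz ->]]].
    (* The point one unit to the right is represented by [phi z] with the same [n] if [sg = 1], and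
       by [z] with [S n] if [sg = -1]. *)
    rewrite HP by easy. destruct (tm_sign _ _ _ _ T) as [Sg|Sg].
    + replace (h z - RtoC (INR n * sg) + 1)%C with (h (phi z) - RtoC (INR n * sg))%C
        by (rewrite (tm_semiconj _ _ _ _ T) by easy; rewrite Sg; ring).
      rewrite HP by (now apply Hphi).
      rewrite Hc, (tm_semiconj _ _ _ _ T), Sg by (auto; now apply Hpsi). ring.
    + assert (Q : forall v, (v - RtoC (INR n * sg) + 1)%C = (v - RtoC (INR (S n) * sg))%C).
      { intros v. rewrite S_INR, Rmult_plus_distr_r, RtoC_plus, Sg, Rmult_1_l.
        replace (RtoC (-1)) with (- RtoC 1)%C by (rewrite <- RtoC_opp; easy). ring. }
      rewrite !Q. now apply HP.
Qed.

(** Each point, shifted far enough, lies in the image of [V], which is open; so a neighbourhood does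
    too, and larger shifts preserve this because [phi] maps [V] into itself ([Up]). Bisection makes
    the shift uniform over the rectangle. *)
Lemma model_rectangle phi sg h V a b c d :
  translation_model phi sg h V -> a <= b -> c <= d -> 0 < c ->
  exists k, forall n v, (k <= n)%nat -> a <= Re v <= b -> c <= Im v <= d ->
    exists z, V z /\ h z = (v + RtoC (INR n * sg))%C.
Proof.
  intros T Hab Hcd Hc.
  assert (Up : forall k n v, (k <= n)%nat -> (exists z, V z /\ h z = (v + RtoC (INR k * sg))%C) ->
    exists z, V z /\ h z = (v + RtoC (INR n * sg))%C).
  { intros k n v L [z [Vz E]]. exists (iterate phi (n - k) z). split.
    - destruct (Nat.eq_dec n k); [|].
      + replace (n - k)%nat with 0%nat by lia. easy.
      + clear L. induction (n - k)%nat; simpl; [easy|now apply T].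
    - rewrite (model_iterate _ _ _ _ _ _ T), E by (now apply (tm_disc _ _ _ _ T)).
      rewrite <- Cplus_assoc, <- RtoC_plus, <- Rmult_plus_distr_r, <- plus_INR.
      do 4 f_equal. f_equal. lia. }
  apply (bisection (fun a b c d => exists k, forall n v, (k <= n)%nat -> a <= Re v <= b ->
    c <= Im v <= d -> exists z, V z /\ h z = (v + RtoC (INR n * sg))%C)); auto.
  - intros a' b' c' d' _ _ _ _ _ _ [k1 H1] [k2 H2] [k3 H3] [k4 H4].
    exists (max (max k1 k2) (max k3 k4)). intros n v Hn Hx Hy.
    destruct (Rle_dec (Re v) ((a' + b') / 2)); destruct (Rle_dec (Im v) ((c' + d') / 2)).
    + apply H1; [lia|lra|lra].
    + apply H3; [lia|lra|lra].
    + apply H2; [lia|lra|lra].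
    + apply H4; [lia|lra|lra].
  - intros x y Hx Hy.
    destruct (model_exhaust_V _ _ _ _ (x, y) T) as [k [z [Vz E]]]; [simpl; lra|].
    destruct (model_inverse _ _ _ _ T) as [g [_ Hg]]. destruct (Hg z Vz) as [_ [e [He He']]].
    exists (e / 2). split; [lra|]. intros a' b' c' d' Ha Hb Hc' Hd L1 L2.
    exists k. intros n v Hn Hvx Hvy. apply (Up k n v Hn). apply He'.
    rewrite E. replace (v + RtoC (INR k * sg) - ((x, y) + RtoC (INR k * sg)))%C
      with (v - (x, y))%C by ring.
    eapply Rle_lt_trans; [apply Cmod_le_Re_Im|]. rewrite Re_minus.
    change (Im (v - (x, y))%C) with (Im v - y). simpl (Re (x, y)).
    assert (Rabs (Re v - x) < e / 2) by (apply Rabs_lt_between; lra).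
    assert (Rabs (Im v - y) < e / 2) by (apply Rabs_lt_between; lra). lra.
Qed.

(* The discs of the half-plane are eventually pulled back by inverse branches of
   [h], so the hyperbolic metric of the model is the limit of that of the orbits. *)
Lemma model_pull_back phi sg h V z z0 R :
  translation_model phi sg h V -> Cmod z < 1 -> Cmod z0 < 1 ->
  R < Im (h z0) -> Cmod (h z - h z0) < R ->
  exists k, R * pseudo_hyperbolic (iterate phi k z) (iterate phi k z0) <= Cmod (h z - h z0).
Proof.
  intros T Hz Hz0 HR Hzz. assert (HR0 : 0 < R) by (generalize (Cmod_ge_0 (h z - h z0)); lra).
  destruct (model_eventually _ _ _ _ z T Hz) as [N1 H1].
  destruct (model_eventually _ _ _ _ z0 T Hz0) as [N2 H2].
  destruct (model_rectangle phi sg h V (Re (h z0) - R) (Re (h z0) + R) (Im (h z0) - R)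
     (Im (h z0) + R) T) as [N3 H3]; try lra.
  set (k := max N1 (max N2 N3)). exists k.
  destruct (model_inverse _ _ _ _ T) as [g [Hg Hg']].
  assert (Br : forall v, Cmod (v - h z0) < R ->
     exists u, V u /\ h u = (v + RtoC (INR k * sg))%C).
  { intros v Hv. assert (B := Cmod_box v (h z0) R (Rlt_le _ _ Hv)). apply H3; [lia|lra|lra]. }
  assert (Eg : forall w, Cmod w < 1 -> V (iterate phi k w) ->
     g (h w + RtoC (INR k * sg))%C = iterate phi k w).
  { intros w Hw Vw. rewrite <- (model_iterate _ _ _ _ _ _ T) by easy. now apply Hg. }
  (* By [Br] this inverse branch is defined on the whole disc about [h z0], and it takes [h z] and
     [h z0] to the [k]-th iterates of [z] and [z0]. *)
  assert (S := schwarz_pick_ball_disc (fun v => g (v + RtoC (INR k * sg))%C) (h z0) R (h z)).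
  cbv beta in S.
  rewrite !Eg in S; [|easy|apply H2; lia|easy|apply H1; lia].
  apply pseudo_hyperbolic_le; auto.
  - apply (tm_disc _ _ _ _ T), H1; lia.
  - apply (tm_disc _ _ _ _ T), H2; lia.
  - apply S; auto.
    + intros v Hv. destruct (Br v Hv) as [u [Vu Eu]].
      apply (holo_comp g (fun v => v + RtoC (INR k * sg))%C).
      * apply holo_plus; auto using holo_const, holo_id.
      * rewrite <- Eu. now apply Hg'.
    + intros v Hv. destruct (Br v Hv) as [u [Vu Eu]].
      rewrite <- Eu, Hg by easy. now apply (tm_disc _ _ _ _ T).
Qed.

(** * Zero step, positive step and the equivalence in the half-plane model *)

Lemma translation_centralizer_zero_step phi psi sg h V Psi :
  translation_model phi sg h V -> disc_map psi ->
  (forall z, Cmod z < 1 -> psi (phi z) = phi (psi z)) ->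
  half_plane_map Psi -> (forall w, 0 < Im w -> Im w < Im (Psi w)) ->
  (forall z, Cmod z < 1 -> h (psi z) = Psi (h z)) ->
  ~ positive_hyperbolic_step (fun z => phi (psi z)).
Proof.
  intros T Hpsi Hc HP Hs Hh. assert (Hphi := tm_phi _ _ _ _ T).
  assert (Hf := disc_map_comp _ _ Hphi Hpsi).
  apply zero_step_intro; [easy|]. intros z eps Hz He.
  assert (Hw := tm_Im _ _ _ _ T z Hz).
  assert (Hit : forall n, h (iterate psi n z) = Nat.iter n Psi (h z)).
  { induction n as [|n IH]; [easy|]. simpl.
    rewrite Hh by (apply (disc_map_iterate psi n); easy). now f_equal. }
  destruct (half_plane_map_bounds Psi (Im (h z)) HP Hs Hw) as [m [M [Hm [HM HB]]]].
  assert (Mono : forall n, Im (h z) <= Im (Nat.iter n Psi (h z))).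
  { induction n as [|n IH]; simpl; [lra|]. destruct (HB _ IH). lra. }
  (* [M + 1] bounds the distance from [h x] to [h y]: a displacement by [Psi] and one unit
     translation. The first summand makes [(M + 1) / R] at most [eps], the second makes [R] exceed
     that distance. *)
  set (R := (M + 1) / eps + (M + 2)).
  assert (HR : 0 < (M + 1) / eps) by (apply Rdiv_lt_0_compat; lra).
  destruct (half_plane_map_escape Psi (h z) R HP Hs Hw) as [n Hn].
  set (x := iterate psi n z). set (y := iterate psi n (phi (psi z))).
  assert (Hx : Cmod x < 1) by (now apply disc_map_iterate).
  assert (Hy : Cmod y < 1) by (apply disc_map_iterate; [easy|now apply Hf]).
  destruct (HB _ (Mono n)) as [B1 B2].
  assert (Ey : h y = (Psi (h x) + RtoC sg)%C).
  { unfold y. assert (Dz : Cmod (psi z) < 1) by (now apply Hpsi).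
    assert (E := iterate_comm phi psi 1 n (psi z) Hphi Hpsi Hc Dz). simpl in E.
    rewrite E, (tm_semiconj _ _ _ _ T) by (now apply disc_map_iterate).
    rewrite <- iterate_succ_r. simpl. rewrite Hh by easy. easy. }
  assert (Ex : h x = Nat.iter n Psi (h z)) by apply Hit.
  assert (Sg : Cmod (RtoC sg) = 1).
  { rewrite Cmod_R. destruct (tm_sign _ _ _ _ T) as [->| ->];
      [apply Rabs_R1|rewrite Rabs_left; lra]. }
  assert (Dxy : Cmod (h x - h y) <= M + 1).
  { rewrite Cmod_sub_sym, Ey.
    replace (Psi (h x) + RtoC sg - h x)%C with ((Psi (h x) - h x) + RtoC sg)%C by ring.
    eapply Rle_trans; [apply Cmod_triangle|]. rewrite Sg, Ex. lra. }
  destruct (model_pull_back phi sg h V x y R T Hx Hy) as [k Hk].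
  - rewrite Ey, Im_plus_R, Ex. lra.
  - unfold R. lra.
  - assert (Sm : pseudo_hyperbolic (iterate phi k x) (iterate phi k y) <= eps).
    { apply Rmult_le_reg_l with R; [unfold R; lra|].
      apply Rle_trans with (M + 1); [lra|].
      replace (R * eps) with (M + 1 + (M + 2) * eps) by (unfold R; field; lra). nra. }
    exists (max k n). intros j Hj. eapply Rle_trans; [|exact Sm].
    assert (Split : forall v, Cmod v < 1 -> iterate (fun z => phi (psi z)) j v =
       iterate phi (j - k) (iterate psi (j - n) (iterate phi k (iterate psi n v)))).
    { intros v Hv. rewrite iterate_compose by easy.
      replace j with ((j - k) + k)%nat at 1 by lia. rewrite iterate_plus. f_equal.
      replace j with ((j - n) + n)%nat at 1 by lia. rewrite iterate_plus.
      symmetry. apply iterate_comm; auto. now apply disc_map_iterate. }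
    rewrite iterate_succ_r, !Split by (try easy; now apply Hf).
    fold x y.
    assert (Kx := disc_map_iterate phi k x Hphi Hx).
    assert (Ky := disc_map_iterate phi k y Hphi Hy).
    eapply Rle_trans; [apply iterate_contract; auto; now apply disc_map_iterate|].
    now apply iterate_contract.
Qed.

(** The points 0 and [phi (psi 0)] have equal image under [h], so a late iterate [a] of 0 is fixed
    by [phi o psi] and lies in [V]. Fixing [a] is what keeps nearby points inside [V], where
    preserving [h] means being the identity. *)
Lemma model_fixed_identity phi psi sg h V :
  translation_model phi sg h V -> disc_map psi ->
  (forall z, Cmod z < 1 -> psi (phi z) = phi (psi z)) ->
  (forall z, Cmod z < 1 -> h (phi (psi z)) = h z) ->
  forall z, Cmod z < 1 -> phi (psi z) = z.
Proof.
  intros T Hpsi Hc Hh. assert (Hphi := tm_phi _ _ _ _ T).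
  assert (Hf := disc_map_comp _ _ Hphi Hpsi).
  assert (D0 : Cmod (RtoC 0) < 1) by (rewrite Cmod_0; lra).
  destruct (model_eq_eventually _ _ _ _ (RtoC 0) (phi (psi (RtoC 0))) T D0) as [N [VN EN]].
  { now apply Hf. }
  { now rewrite Hh. }
  set (a := iterate phi N (RtoC 0)) in *.
  assert (Da := tm_disc _ _ _ _ T a VN).
  assert (Fa : phi (psi a) = a).
  { transitivity (iterate phi N (phi (psi (RtoC 0)))); [|now symmetry]. unfold a.
    assert (E := iterate_comm phi (fun z => phi (psi z)) N 1 (RtoC 0) Hphi Hf). simpl in E.
    apply E; [|easy]. intros w Hw. now rewrite Hc. }
  destruct (tm_open _ _ _ _ T a VN) as [r [Hr Vr]].
  destruct (holo_cont _ _ (proj1 Hf a Da) r Hr) as [d [Hd Hd']]. cbv beta in Hd'. rewrite Fa in Hd'.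
  intros z Hz.
  apply (identity_disc (fun z => phi (psi z)) (fun z => z) a (Rmin r d)); auto using holo_id.
  - apply Hf.
  - apply Hf.
  - now apply Rmin_pos.
  - intros w Hw.
    assert (Vw : V w) by (apply Vr; generalize (Rmin_l r d); lra).
    apply (tm_injective _ _ _ _ T); [|easy|].
    + apply Vr, Hd'. generalize (Rmin_r r d). lra.
    + now apply Hh, (tm_disc _ _ _ _ T).
Qed.

Lemma model_translation_positive_step phi sg h V f d :
  translation_model phi sg h V -> disc_map f -> d <> 0 ->
  (forall z, Cmod z < 1 -> h (f z) = (h z + RtoC d)%C) ->
  positive_hyperbolic_step f.
Proof.
  intros T Hf Hd Hh.
  assert (D0 : Cmod (RtoC 0) < 1) by (rewrite Cmod_0; lra).
  set (y := Im (h (RtoC 0))). assert (Hy : 0 < y) by (now apply (tm_Im _ _ _ _ T)).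
  apply Rabs_pos_lt in Hd.
  (* Along the orbit [h] keeps the height [y], and a translation by [d] at that height has
     pseudo-hyperbolic length at least [Rabs d / (Rabs d + 2 * y)]; [h] does not increase that
     length. *)
  apply (positive_step_intro f (RtoC 0) (Rabs d / (Rabs d + 2 * y))); auto.
  { apply Rdiv_lt_0_compat; lra. }
  intros n. set (z := iterate f n (RtoC 0)).
  assert (Hz : Cmod z < 1) by (now apply disc_map_iterate).
  assert (Hz' : Cmod (f z) < 1) by (now apply Hf).
  change (iterate f (S n) (RtoC 0)) with (f z).
  assert (Ey : Im (h (f z)) = y).
  { rewrite Hh, Im_plus_R by easy. unfold z. clear z Hz Hz'.
    induction n as [|n IH]; [easy|]. simpl. rewrite Hh, Im_plus_R; [easy|].
    now apply (disc_map_iterate f n). }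
  assert (S := schwarz_pick_disc_half h z (f z) (tm_holo _ _ _ _ T) (tm_Im _ _ _ _ T) Hz' Hz).
  assert (B := Cmod_sub_conj_le (h z) (h (f z)) ltac:(lra)). rewrite Ey in B.
  assert (E : Cmod (h z - h (f z)) = Rabs d).
  { rewrite Hh, Cmod_sub_sym by easy. rewrite <- Cmod_R. f_equal. ring. }
  rewrite E in *. rewrite <- (pseudo_hyperbolic_mult z (f z) Hz Hz') in S.
  assert (P : 0 < Cmod (1 - Cconj (f z) * z)).
  { generalize (disc_mobius_lt z (f z) Hz Hz') (Cmod_ge_0 (z - f z)). lra. }
  apply Rle_div_l; [lra|].
  apply Rmult_le_reg_r with (Cmod (1 - Cconj (f z) * z)); [easy|].
  eapply Rle_trans; [exact S|].
  rewrite (Rmult_comm (pseudo_hyperbolic _ _ * (_ + _))), (Rmult_comm (pseudo_hyperbolic _ _)), Rmult_assoc.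
  apply Rmult_le_compat_l; [lra|]. apply Rmult_le_compat_l; [apply Cmod_ge_0|easy].
Qed.

(** The relation between [beta] and [psi] is given only on the image of [h]; the translates of that
    image exhaust the half-plane, and both [beta] and [Psi] are compatible with the translations. *)
Lemma model_beta_conjugate phi psi sg h V Psi beta c :
  translation_model phi sg h V -> disc_map psi ->
  (forall n z, Cmod z < 1 -> Psi (h z - RtoC (INR n * sg))%C = (h (psi z) - RtoC (INR n * sg))%C) ->
  (forall w, 0 < Im w -> beta (w + 1)%C = (beta w + 1)%C) ->
  (forall z, Cmod z < 1 -> beta (h (psi z)) = (beta (h z) + c)%C) ->
  forall w, 0 < Im w -> beta (Psi w) = (beta w + c)%C.
Proof.
  intros T Hpsi HP Hb1 Hb w Hw.
  assert (Up : forall n w, 0 < Im w -> beta (w + RtoC (INR n))%C = (beta w + RtoC (INR n))%C).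
  { clear w Hw. induction n as [|n IH]; intros w Hw.
    - simpl. replace (w + 0)%C with w by ring. ring.
    - rewrite S_INR, RtoC_plus.
      replace (w + (RtoC (INR n) + 1))%C with (w + RtoC (INR n) + 1)%C by ring.
      rewrite Hb1, IH by (rewrite ?Im_plus_R; easy). ring. }
  assert (Sh : forall n w, 0 < Im w ->
    beta (w - RtoC (INR n * sg))%C = (beta w - RtoC (INR n * sg))%C).
  { clear w Hw. intros n w Hw. destruct (tm_sign _ _ _ _ T) as [->| ->].
    - rewrite Rmult_1_r.
      assert (E := Up n (w - RtoC (INR n))%C).
      replace (w - RtoC (INR n) + RtoC (INR n))%C with w in E by ring.
      rewrite E; [ring|]. unfold Cminus. now rewrite <- RtoC_opp, Im_plus_R.
    - replace (RtoC (INR n * -1)) with (- RtoC (INR n))%C by (rewrite <- RtoC_opp; f_equal; ring).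
      replace (w - - RtoC (INR n))%C with (w + RtoC (INR n))%C by ring. rewrite Up by easy. ring. }
  destruct (tm_exhaust _ _ _ _ T w Hw) as [n [z [Hz ->]]].
  rewrite HP by easy. rewrite !Sh, Hb by (try easy; apply (tm_Im _ _ _ _ T); try easy; now apply Hpsi).
  ring.
Qed.

(** The dichotomy for [Psi] settles both sides at once: if it raises all heights, both are false; if
    it is a real translation, both are true. *)
Theorem model_step_iff phi psi sg h V beta c :
  translation_model phi sg h V -> disc_map psi ->
  (forall z, Cmod z < 1 -> psi (phi z) = phi (psi z)) ->
  ~ (forall z, Cmod z < 1 -> phi (psi z) = z) ->
  (forall w, 0 < Im w -> holo beta w) ->
  (forall w, 0 < Im w -> beta (w + 1)%C = (beta w + 1)%C) ->
  (forall z, Cmod z < 1 -> beta (h (psi z)) = (beta (h z) + c)%C) ->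
  (positive_hyperbolic_step (fun z => phi (psi z)) <-> Im c = 0).
Proof.
  intros T Hpsi Hc Nid Hb Hb1 Hbc. assert (Hphi := tm_phi _ _ _ _ T).
  destruct (model_conjugate phi psi sg h V T Hpsi Hc) as [Psi [HP HPn]].
  assert (HbP := model_beta_conjugate _ _ _ _ _ _ _ _ T Hpsi HPn Hb1 Hbc).
  assert (Hh : forall z, Cmod z < 1 -> h (psi z) = Psi (h z)).
  { intros z Hz. assert (E := HPn 0%nat z Hz). simpl in E. rewrite Rmult_0_l in E.
    replace (h z - 0)%C with (h z) in E by ring. rewrite E. ring. }
  destruct (classic (forall w, 0 < Im w -> Im w < Im (Psi w))) as [Hs|Ns].
  - split; intros H; exfalso.
    + revert H. now apply (translation_centralizer_zero_step phi psi sg h V Psi).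
    + revert H. now apply (abel_coeff_nonreal Psi beta c).
  - assert (Ex : exists w, 0 < Im w /\ Im (Psi w) = Im w).
    { apply NNPP. intros N. apply Ns. intros w Hw.
      destruct (half_plane_map_Im_le Psi w HP Hw) as [|E]; [easy|].
      elim N. now exists w. }
    destruct Ex as [w0 [Hw0 E0]].
    set (a := Re (Psi w0) - Re w0).
    assert (Ea : forall w, 0 < Im w -> Psi w = (w + RtoC a)%C).
    { intros w Hw. replace (Psi w) with (w + (Psi w - w))%C by ring.
      rewrite (half_plane_map_rigid Psi w0 HP Hw0 E0 w Hw). f_equal.
      apply injective_projections; [easy|]. simpl. unfold Im in E0. lra. }
    split; intros _.
    + apply (abel_coeff_real beta a c Hb Hb1). intros w Hw. now rewrite <- Ea, HbP.
    + assert (Hf : forall z, Cmod z < 1 -> h (phi (psi z)) = (h z + RtoC (a + sg))%C).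
      { intros z Hz. rewrite (tm_semiconj _ _ _ _ T), Hh, Ea, RtoC_plus
          by (try easy; try (now apply (tm_Im _ _ _ _ T)); now apply Hpsi). ring. }
      apply (model_translation_positive_step phi sg h V _ (a + sg) T); auto.
      * now apply disc_map_comp.
      * intros Z. apply Nid. apply (model_fixed_identity phi psi sg h V T Hpsi Hc).
        intros z Hz. rewrite Hf, Z by easy. ring.
Qed.

(** * From the canonical model to the normalized translation model *)

Lemma open_ball V w :
  @open C_UniformSpace V -> V w -> exists r, 0 < r /\ forall v, Cmod (v - w) < r -> V v.
Proof.
  intros O Vw. destruct (O w Vw) as [r Hr]. exists r. split; [apply cond_pos|].
  intros v Hv. now apply Hr, C_NormedModule_mixin_compat1.
Qed.

Lemma disc_map_of_self_map f : holomorphic_self_map f -> disc_map f.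
Proof.
  intros [Hh Hm]. split; [|exact Hm]. intros z Hz. apply holo_of_ex_derive, Hh, Hz.
Qed.

Lemma translation_model_upper phi h :
  holomorphic_self_map phi -> canonical_model phi upper_half_plane h ->
  exists V, translation_model phi 1 h V.
Proof.
  intros Hphi [_ Hh Hm Hs He [V [[[VO [_ _]] [Vd [Vi Va]]] Vinj]] _].
  exists V. split; auto.
  - now apply disc_map_of_self_map.
  - intros z Hz. apply holo_of_ex_derive, Hh, Hz.
  - intros w Hw. destruct (proj1 (He w) Hw) as [n [z [Hz ->]]]. exists n, z.
    now rewrite Rmult_1_r.
  - intros w. now apply open_ball.
Qed.

Lemma translation_model_lower phi h :
  holomorphic_self_map phi -> canonical_model phi lower_half_plane h ->
  exists V, translation_model phi (-1) (fun z => - h z)%C V.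
Proof.
  intros Hphi [_ Hh Hm Hs He [V [[[VO [_ _]] [Vd [Vi Va]]] Vinj]] _].
  assert (N1 : RtoC (-1) = (- RtoC 1)%C) by (rewrite <- RtoC_opp; easy).
  exists V. split; auto.
  - now apply disc_map_of_self_map.
  - intros z Hz. apply (holo_ext_loc (fun z => RtoC (-1) * h z)%C _ z 1 Rlt_0_1).
    + intros w _. rewrite N1. ring.
    + apply holo_mult; auto using holo_const. apply holo_of_ex_derive, Hh, Hz.
  - intros z Hz. specialize (Hm z Hz). unfold lower_half_plane in Hm.
    change (Im (- h z)%C) with (- Im (h z)). lra.
  - intros z Hz. rewrite Hs, N1 by easy. ring.
  - intros w Hw. destruct (proj1 (He (- w)%C)) as [n [z [Hz E]]].
    + unfold lower_half_plane. change (Im (- w)%C) with (- Im w). lra.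
    + exists n, z. split; [easy|]. rewrite RtoC_mult, N1.
      replace w with (- - w)%C by ring. rewrite E. ring.
  - intros w. now apply open_ball.
  - intros z w Vz Vw E. apply Vinj; auto.
    replace (h z) with (- - h z)%C by ring. rewrite E. ring.
Qed.

Theorem theorem6p2 :
  forall (phi psi : C -> C) (c : C),
    parabolic phi ->
    positive_hyperbolic_step phi ->
    centralizer phi psi ->
    ~ (forall z, unit_disc z -> phi (psi z) = z) ->
    is_simultaneous_linearization_coeff phi psi c ->
    (positive_hyperbolic_step (fun z => phi (psi z)) <-> Im c = 0).
Proof.
  intros phi psi c [Hphi _] _ [Hpsi Hc] Nid [S [h [CM [beta [Hb [Hb1 [_ Hbc]]]]]]].
  apply disc_map_of_self_map in Hpsi.
  destruct (cm_half_plane _ _ _ CM) as [E|E]; subst S.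
  - destruct (translation_model_upper phi h Hphi CM) as [V T].
    apply (model_step_iff phi psi 1 h V beta c T); auto.
    intros w Hw. apply holo_of_ex_derive, Hb, Hw.
  - destruct (translation_model_lower phi h Hphi CM) as [V T].
    assert (Lo : forall w, 0 < Im w -> lower_half_plane (- w)%C).
    { intros w Hw. unfold lower_half_plane. change (Im (- w)%C) with (- Im w). lra. }
    (* Conjugation by [w => - w], which moves the model to the upper half-plane, turns [beta] into
       [- beta (- w)] and [c] into [- c], while the unit translation law for [beta] keeps its
       sign. *)
    assert (Q : Im c = 0 <-> Im (- c)%C = 0)
      by (change (Im (- c)%C) with (- Im c); split; lra).
    rewrite Q.
    apply (model_step_iff phi psi (-1) (fun z => - h z)%C V (fun w => - beta (- w))%C (- c)%C T);
      auto.
    + intros w Hw.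
      assert (Hn : forall f z, holo f z -> holo (fun z => - f z)%C z).
      { intros f z Hf. apply (holo_ext_loc (fun z => RtoC 0 - f z)%C _ z 1 Rlt_0_1).
        - intros; ring.
        - apply holo_minus; auto using holo_const. }
      apply Hn, (holo_comp beta (fun w => - w)%C).
      * apply Hn, holo_id.
      * apply holo_of_ex_derive, Hb, Lo, Hw.
    + intros w Hw. assert (B := Hb1 (- (w + 1))%C).
      replace (- (w + 1) + RtoC 1)%C with (- w)%C in B by ring. rewrite B; [ring|].
      apply Lo. now rewrite Im_plus_R.
    + intros z Hz.
      assert (D : forall v, (- - v)%C = v) by (intros; ring).
      rewrite !D, Hbc by easy. ring.
Qed.
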